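(* Let $d\ge 1$ be a fixed integer and let $X(t)$, $t\in[0,1]^d$, be the tensor product random field $$X(t)=\sum_{k\in\mathbb{N}^d}\ \prod_{l=1}^d\lambda(k_l)\ \prod_{l=1}^d\phi_{k_l}(t_l)\ \xi_k ,$$ where $(\phi_i)_{i\ge1}$ is an orthonormal system in $L_2([0,1])$, $(\xi_k)_{k\in\mathbb{N}^d}$ are non-correlated random variables with zero mean and unit variance, and $(\lambda(i))_{i\ge 1}$ is a sequence of nonnegative numbers satisfying $$\lambda(i)\sim \mu\, i^{-r}(\ln i)^q,\qquad i\to\infty,$$ for some $\mu>0$, $r>1/2$ and $q\in\mathbb{R}$ with $q\ne -r$. Let $\alpha:=q/r$ and $$\beta:=\begin{cases}(d-1)+d\alpha, & \alpha>-1,\\ \alpha, & \alpha<-1.\end{cases}$$ Then there exist a constant $C=C(X)$ and a sequence of linear approximation algorithms $(A_n)_{n\ge 2}$, where $A_n$ uses $n$ point values, such that for each $n\ge 2$ $$\mathbb{E}\|X-A_nX\|_2^2\le C\, n^{1-2r}(\ln n)^{2r(\beta+1)-1}.$$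
   Context: $\mathbb{N}=\{1,2,\dots\}$; $\|\cdot\|_2$ is the norm of $L_2([0,1]^d)$ with Lebesgue measure. Equivalently, $X$ is a zero mean random field with covariance $\prod_{l=1}^d K(s_l,t_l)$, where $K(s,t)=\sum_{i\ge1}\lambda(i)^2\phi_i(s)\phi_i(t)$ is a covariance kernel on $[0,1]$ with $\sum_i\lambda(i)^2<\infty$. The series defining $X$ is the Karhunen--Loève expansion, converging in mean square; $X$ is jointly measurable and its sample paths are considered as elements of $L_2([0,1]^d)$. A linear approximation algorithm using $n$ point values is a map $Af=\sum_{l=1}^n f(\tau_l)\psi_l$ with fixed non-random points $\tau_l\in[0,1]^d$ and fixed non-random functions $\psi_l\in L_2([0,1]^d)$; these may depend on the distribution of $X$ but not on its realization. The constant $C$ does not depend on $n$. *)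

(* Defs.v *)
From HB Require Import structures.
From mathcomp Require Import all_boot all_order all_algebra.
From mathcomp Require Import all_classical all_reals all_analysis.

Set Implicit Arguments.
Unset Strict Implicit.
Unset Printing Implicit Defensive.
Import Order.TTheory GRing.Theory Num.Theory.
Import numFieldNormedType.Exports.

Local Open Scope classical_set_scope.
Local Open Scope ring_scope.

Section lebesgue_measure_tuple.
Context {R : realType}.
Local Notation Rb := (measurableTypeR R).

Definition tuple_consf (n : nat) (x : Rb * n.-tuple Rb) : n.+1.-tuple Rb :=
  [tuple of x.1 :: x.2].

Lemma measurable_tuple_consf n :
  measurable_fun [set: Rb * n.-tuple Rb] (@tuple_consf n).
Proof. exact: measurable_cons. Qed.

Section step.
Variables (n : nat) (m : {sigma_finite_measure set (n.-tuple Rb) -> \bar R}).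

Definition lebesgue_tupleS : set (n.+1.-tuple Rb) -> \bar R :=
  pushforward ((@lebesgue_measure R) \x m)%E (@tuple_consf n).

Let mf := @measurable_tuple_consf n.

Let lebesgue_tupleS0 : lebesgue_tupleS set0 = 0%E.
Proof. by rewrite /lebesgue_tupleS measure0. Qed.

Let lebesgue_tupleS_ge0 A : (0 <= lebesgue_tupleS A)%E.
Proof. exact: measure_ge0. Qed.

Let lebesgue_tupleS_sigma_additive : semi_sigma_additive lebesgue_tupleS.
Proof. exact: measure_semi_sigma_additive. Qed.

HB.instance Definition _ := isMeasure.Build _ _ _ lebesgue_tupleS
  lebesgue_tupleS0 lebesgue_tupleS_ge0 lebesgue_tupleS_sigma_additive.

Let lebesgue_tupleS_sigma_finite : sigma_finite setT lebesgue_tupleS.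
Proof.
have /sigma_finiteP[F [TF ndF Foo]] :=
  sigma_finiteT (@lebesgue_measure R : {sigma_finite_measure set Rb -> \bar R}).
have /sigma_finiteP[G [TG ndG Goo]] := sigma_finiteT m.
pose g (t : n.+1.-tuple Rb) : Rb * n.-tuple Rb :=
  (thead t, [tuple of behead t]).
have gK : cancel (@tuple_consf n) g.
  by move=> [x t]; rewrite /g/= theadE; congr pair; exact: val_inj.
have mg : measurable_fun setT g.
  apply/measurable_fun_pairP; split; first exact: measurable_tnth.
  exact: measurable_behead.
exists (fun i => g @^-1` (F i `*` G i)).
  apply/seteqP; split=> // t _.
  have [i _ Fi] : (\bigcup_i F i) (g t).1 by rewrite -TF.
  have [j _ Gj] : (\bigcup_i G i) (g t).2 by rewrite -TG.
  exists (maxn i j) => //; split.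
    by move: Fi; exact/subsetPset/ndF/leq_maxl.
  by move: Gj; exact/subsetPset/ndG/leq_maxr.
move=> i; have [mFi Fioo] := Foo i; have [mGi Gioo] := Goo i.
split; first by rewrite -[X in measurable X]setTI; apply: mg => //; exact: measurableX.
rewrite /lebesgue_tupleS /pushforward -comp_preimage.
rewrite (_ : g \o _ = id); last by apply/funext => x /=; exact: gK.
by rewrite preimage_id product_measure1E// lte_mul_pinfty// ge0_fin_numE.
Qed.

HB.instance Definition _ := Measure_isSigmaFinite.Build _ _ _ lebesgue_tupleS
  lebesgue_tupleS_sigma_finite.

End step.

(* Lebesgue measure on the Borel sets of R^d: the d-fold product of the
   one-dimensional one, transported along (x, t) |-> x :: t; on R^0 it is the
   unit mass at the empty tuple. *)
Fixpoint lebesgue_tuple (d : nat) :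
    {sigma_finite_measure set (d.-tuple Rb) -> \bar R} :=
  match d with
  | 0 => \d_([tuple] : 0.-tuple Rb)
  | n.+1 => lebesgue_tupleS (lebesgue_tuple n)
  end.

Lemma lebesgue_tuple_box d (A : 'I_d -> set Rb) :
  (forall l, measurable (A l)) ->
  lebesgue_tuple d [set t | forall l, A l (tnth t l)] =
  (\prod_(l < d) lebesgue_measure (A l))%E.
Proof.
elim: d A => [|n IHn] A mA.
  by rewrite big_ord0 /= diracE mem_set// => -[].
rewrite big_ord_recl -IHn => [|l]; last exact: mA.
rewrite -product_measure1E//; last first.
  rewrite (_ : [set t | _] = \bigcap_(l in [set: 'I_n])
      (@tnth n Rb ^~ l) @^-1` A (lift ord0 l)).
    apply: fin_bigcap_measurable => // l _.
    by rewrite -[X in measurable X]setTI; exact: measurable_tnth.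
  by apply/seteqP; split=> t /= tA l => [_|]; exact: tA.
rewrite /= /lebesgue_tupleS /pushforward; congr (product_measure1 _ _ _).
apply/seteqP; split=> [[x t]/= tA|[x t]/= [Ax tA] l].
  split=> [|l]; first by have := tA ord0.
  by have := tA (lift ord0 l); rewrite tnthS/=.
by case: (unliftP ord0 l) => [j ->|->]; rewrite ?tnthS ?tnth0//; exact: tA.
Qed.

End lebesgue_measure_tuple.
Arguments lebesgue_tuple {R} d.

Section L2_cube.
Context {R : realType}.
Local Notation Rb := (measurableTypeR R).

Definition unit_cube (d : nat) : set (d.-tuple Rb) :=
  [set t | forall l, 0 <= tnth t l <= 1].
Arguments unit_cube d _ : clear implicits.

Definition sqnormL2 (d : nat) (f : d.-tuple Rb -> R) : \bar R :=
  (\int[lebesgue_tuple d]_(t in unit_cube d) ((f t) ^+ 2)%:E)%E.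

Definition in_L2 (d : nat) (f : d.-tuple Rb -> R) : Prop :=
  measurable_fun (unit_cube d) f /\ (sqnormL2 f < +oo)%E.

Definition orthonormal_system (phi : nat -> Rb -> R) : Prop :=
  (forall i, measurable_fun (`[0 : R, 1] : set Rb) (phi i)) /\
  forall i j,
    (\int[@lebesgue_measure R]_(x in `[0%R : R, 1%R]) (phi i x * phi j x)%:E)%E =
    (i == j)%:R%:E.

Record linear_algorithm (d n : nat) := LinearAlgorithm {
  node : 'I_n -> d.-tuple Rb;
  weight : 'I_n -> d.-tuple Rb -> R;
  node_unit_cube : forall l, unit_cube d (node l);
  weight_in_L2 : forall l, in_L2 (weight l) }.

Definition eval_algorithm (d n : nat) (A : linear_algorithm d n)
    (f : d.-tuple Rb -> R) : d.-tuple Rb -> R :=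
  fun t => \sum_(l < n) f (node A l) * weight A l t.

End L2_cube.
Arguments unit_cube {R} d _.

Section tensor_product_field.
Context (R : realType) (d : nat) (dOmega : measure_display)
  (Omega : measurableType dOmega) (P : probability Omega R).
Local Notation Rb := (measurableTypeR R).

(* The index set {1, 2, ...} is encoded by nat through i |-> i + 1, so that
   lambda i, phi i and xi k stand for the objects of index i + 1 and
   (k_1 + 1, ..., k_d + 1). *)
Implicit Types (lambda : nat -> R) (phi : nat -> Rb -> R)
  (xi : d.-tuple nat -> {RV P >-> R}) (X : d.-tuple Rb -> Omega -> R).

Definition uncorrelated_standard xi : Prop :=
  [/\ forall k, ('E_P[xi k] = 0)%E,
      forall k, ('V_P[xi k] = 1)%E &
      forall j k, j != k -> covariance P (xi j) (xi k) = 0%E].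

(* The partial sum over the multi-indices of {1, ..., N}^d. *)
Definition tensor_partial_sum lambda phi xi (N : nat) (t : d.-tuple Rb)
    (w : Omega) : R :=
  \sum_(k : d.-tuple 'I_N)
    (\prod_(l < d) lambda (tnth k l)) *
    (\prod_(l < d) phi (tnth k l) (tnth t l)) *
    xi (map_tuple (@nat_of_ord N) k) w.

Record tensor_product_field lambda phi xi X : Prop := {
  field_jointly_measurable :
    measurable_fun (unit_cube d `*` [set: Omega])
      (fun tw : d.-tuple Rb * Omega => X tw.1 tw.2);
  field_path_in_L2 : {ae P, forall w, in_L2 (X ^~ w)};
  (* The terms being pairwise orthogonal, mean square convergence of the
     partial sums over cubes is the same as unconditional convergence. *)
  field_expansion : forall t, unit_cube d t ->
    ('E_P[fun w =>
       ((X t w - tensor_partial_sum lambda phi xi N t w) ^+ 2)%R])%E @[N --> \oo] --> 0%E }.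

End tensor_product_field.

Definition log_exponent (R : realType) (d : nat) (alpha : R) : R :=
  if -1 < alpha then (d%:R - 1) + d%:R * alpha else alpha.

(* Main.v *)
Require Import Defs.
From HB Require Import structures.
From mathcomp Require Import all_boot all_order all_algebra.
From mathcomp Require Import all_classical all_reals all_analysis.
From mathcomp Require Import measurable_realfun ring lra zify.

Set Implicit Arguments.
Unset Strict Implicit.
Unset Printing Implicit Defensive.
Import Order.TTheory GRing.Theory Num.Theory.
Import numFieldNormedType.Exports.

Local Open Scope classical_set_scope.
Local Open Scope ring_scope.

(** The products tensor phi k of the functions phi_i diagonalise the covariance
of X.  Hence the mean square error of a linear algorithm A with fixed nodes and
weights is controlled, up to a factor 2, by the deterministic sum over the
multi-indices k of c_k ||tensor phi k - A (tensor phi k)||^2, where c_k is the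
square of the product of the lambda (k_l): this is
[integral_square_error_le].  It remains to find nodes that are good for all the
functions tensor phi k simultaneously, on weighted average.

Fix a finite set S of m multi-indices, let V be the span of the corresponding
products and let t be the sum of the c_k over k outside S.  The nodes come from
a derandomised Kaczmarz iteration.  Given an algorithm A with values in V, a new
node x and the correction of A that moves the approximation towards
interpolation at x, along the kernel of V at x, change the squared norm of the
part of the error that lies in V by (h_k(x)^2 - p_k(x)^2) / w(x), where p_k and h_k are the parts
of the current error of tensor phi k in V and orthogonal to V, and w is the sum
of the squares of the orthonormal basis of V.  Averaged over x with density
w / m, the weighted error D in V becomes (1 - 1/m) D + t / m, so some x does at
least as well ([kaczmarz_step]).  After n nodes the total error is at most
(1 - 1/m)^n W + 2 t, W being the sum of all c_k ([kaczmarz_algorithm]).  The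
first term is negligible as soon as m is of order n / ln n, and this is where
the power 2r - 1 of the logarithm is lost against the best approximation from a
space of dimension n.

The sets S are hyperbolic crosses adapted to lambda.  With alpha = q / r, the
integers are cut into blocks in such a way that the j-th one has at most
2^j (j+1)^alpha elements and that lambda is bounded by a multiple of 2^(-r j)
on it ([eigen_blocks]).  The product of the lambda (k_l) is then at most a
multiple of 2^(-r P), where P is the sum of the block numbers of the k_l, and
the number of multi-indices with a given P is at most 2^P times the d-fold
convolution of (j+1)^alpha.  This convolution is of order (P+1)^beta: for
alpha > -1 each convolution adds alpha + 1 to the exponent, whereas for
alpha < -1 the sequence is summable and reproduces itself
([size_level_seqs_le]).  Taking for S the multi-indices with P <= p gives m at
most of order 2^p (p+1)^beta and t at most of order 2^((1-2r) p) (p+1)^beta.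
The choice of p for which n is comparable with 2^p (p+1)^(beta+1) yields the
stated rate ([rate_choice]). *)

(** * Orthonormal systems *)

Definition orthonormal_on {R : realType} {dT} {T : measurableType dT}
    (mu : {measure set T -> \bar R}) (D : set T) (f : nat -> T -> R) : Prop :=
  (forall i, measurable_fun D (f i)) /\
  forall i j, (\int[mu]_(x in D) (f i x * f j x)%:E)%E = (i == j)%:R%:E.

Section orthonormal.
Context {R : realType} {dT} {T : measurableType dT}
  (mu : {measure set T -> \bar R}) (D : set T) (mD : measurable D)
  (f : nat -> T -> R) (f_orth : orthonormal_on mu D f).

Let mf i : measurable_fun D (f i). Proof. exact: f_orth.1. Qed.

Lemma orthonormal_integrable_sqr i :
  mu.-integrable D (EFin \o (fun x => f i x ^+ 2)).
Proof.
apply/integrableP; split.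
  by apply/measurable_EFinP/measurable_funX/mf.
rewrite (_ : (\int[mu]_(x in D) _)%E = 1%E) ?ltry//.
have := f_orth.2 i i; rewrite eqxx => <-.
by apply: eq_integral => x _; rewrite /= ger0_norm ?sqr_ge0// expr2.
Qed.

Lemma orthonormal_integrable i j :
  mu.-integrable D (EFin \o (fun x => f i x * f j x)).
Proof.
apply: (@le_integrable _ _ _ mu D mD _
  ((EFin \o (fun x => (f i x ^+ 2)%R)) \+ (EFin \o (fun x => (f j x ^+ 2)%R)))%E).
- exact/measurable_EFinP/measurable_funM.
- move=> x Dx /=; rewrite lee_fin [leRHS]ger0_norm ?addr_ge0 ?sqr_ge0//.
  rewrite ler_norml; apply/andP; split; nra.
- by apply: integrableD => //; exact: orthonormal_integrable_sqr.
Qed.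

Lemma parseval (S : seq nat) (a : nat -> R) : uniq S ->
  (\int[mu]_(x in D) ((\sum_(s <- S) a s * f s x) ^+ 2)%:E)%E =
  (\sum_(s <- S) a s ^+ 2)%:E.
Proof.
move=> uS.
under eq_integral => x _.
  rewrite expr2 mulr_suml.
  under eq_bigr => i _.
    rewrite mulr_sumr.
    under eq_bigr => j _ do rewrite mulrACA.
    over.
  rewrite -sumEFin.
  under eq_bigr do rewrite -sumEFin.
  over.
have int1 i j : mu.-integrable D (fun x => (a i * a j * (f i x * f j x))%:E).
  by under eq_fun do rewrite EFinM; apply: integrableZl => //; exact: orthonormal_integrable.
rewrite integral_sum//; last first.
  by move=> i; apply: integrable_sum => // j _; exact: int1.
rewrite -sumEFin; apply: eq_big_seq => i iS.
rewrite integral_sum//.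
under eq_bigr => j _.
  under eq_integral do rewrite EFinM.
  rewrite integralZl ?f_orth.2//; last exact: orthonormal_integrable.
  over.
rewrite (bigD1_seq i)//= eqxx mule1 big1_seq ?adde0 ?expr2// => j /andP[ji _].
by rewrite eq_sym (negbTE ji) mule0.
Qed.

End orthonormal.

(** * Choosing sampling points by averaging *)

(** The averaging principle behind the choice of a node.  If F exceeded G
wherever w does not vanish, then F >= G everywhere, so the inequality between
the integrals would force F = G almost everywhere, that is w = 0 almost
everywhere. *)
Lemma exists_le_of_integral_le {R : realType} {dT} {T : measurableType dT}
    (mu : {measure set T -> \bar R}) (D : set T) (F G : T -> \bar R)
    (w : T -> R) :
  measurable D -> measurable_fun D F -> measurable_fun D G ->
  measurable_fun D w ->
  (forall x, D x -> 0 <= F x)%E -> (forall x, D x -> 0 <= G x)%E ->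
  (forall x, D x -> w x = 0 -> G x = 0%E) ->
  (\int[mu]_(x in D) F x <= \int[mu]_(x in D) G x)%E ->
  (\int[mu]_(x in D) G x < +oo)%E ->
  (\int[mu]_(x in D) (w x)%:E)%E != 0%E ->
  exists x, [/\ D x, w x != 0 & (F x <= G x)%E].
Proof.
move=> mD mF mG mw F0 G0 wG FG Goo w0; apply: contrapT => /forallNP noex.
have GF x : D x -> w x != 0 -> (G x < F x)%E.
  by move=> Dx wx; rewrite ltNge; apply/negP => FGx; apply: (noex x).
have Gfin x : D x -> G x \is a fin_num.
  move=> Dx; have [/wG->//|wx] := eqVneq (w x) 0.
  by rewrite ge0_fin_numE ?G0// (lt_le_trans (GF _ _ _))// leey.
pose H x := (F x - G x)%E.
have mH : measurable_fun D H by exact: emeasurable_funB.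
have H0 x : D x -> (0 <= H x)%E.
  move=> Dx; rewrite /H sube_ge0 ?Gfin//.
  have [/wG->//|wx] := eqVneq (w x) 0; first exact: F0.
  exact/ltW/GF.
have intF : (\int[mu]_(x in D) F x)%E =
    (\int[mu]_(x in D) G x + \int[mu]_(x in D) H x)%E.
  rewrite -ge0_integralD//; apply: eq_integral => x /set_mem Dx.
  by rewrite /H addeC subeK// Gfin.
have Gnum : (\int[mu]_(x in D) G x)%E \is a fin_num.
  by rewrite ge0_fin_numE// integral_ge0.
have intH : (\int[mu]_(x in D) H x)%E = 0%E.
  apply/eqP; rewrite eq_le integral_ge0// andbT.
  by rewrite -(leeD2lE _ _ Gnum) -intF adde0.
have : ae_eq mu D H (cst 0%E).
  apply/ae_eq_integral_abs => //; rewrite -intH.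
  by apply: eq_integral => x /set_mem Dx; rewrite gee0_abs// H0.
move=> H_ae; case/eqP: w0.
transitivity (\int[mu]_(x in D) (cst 0 x : \bar R))%E; last by rewrite integral0.
apply: ae_eq_integral => //; first exact/measurable_EFinP.
apply: filterS H_ae => x HDx Dx; have /= := HDx Dx.
have [->//|wx] := eqVneq (w x) 0.
by move=> Hx; have := GF _ Dx wx; rewrite -sube_gt0 -/(H x) Hx ltxx.
Qed.

Section kaczmarz_step.
Context {R : realType} {dT} {T : measurableType dT}
  (mu : {measure set T -> \bar R}) (D : set T) (mD : measurable D)
  (f : nat -> T -> R) (f_orth : orthonormal_on mu D f).
Variables (c : nat -> R) (S : seq nat).
Hypotheses (c_ge0 : forall k, 0 <= c k) (uS : uniq S) (S_gt0 : (0 < size S)%N).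

(** The reciprocal of the Christoffel function of the span of the f_s, s in S;
divided by the size of S it is a probability density. *)
Definition christoffel (x : T) : R := \sum_(s <- S) f s x ^+ 2.
(** A family of coefficients d k s encodes, for each k, the component
sum_s d k s f_s of the current error of f_k in the span; the remaining component
of the error is f_k itself if k is outside S, and zero otherwise. *)
Definition span_part (d : nat -> nat -> R) (k : nat) (x : T) : R :=
  \sum_(s <- S) d k s * f s x.
Definition tail_part (k : nat) (x : T) : R := (k \notin S)%:R * f k x.
Definition energy (d : nat -> nat -> R) : \bar R :=
  (\sum_(0 <= k <oo) (c k * \sum_(s <- S) d k s ^+ 2)%:E)%E.
Definition tail_energy : \bar R :=
  (\sum_(0 <= k <oo) (c k * (k \notin S)%:R)%:E)%E.
(** The effect on the coefficients of the error of adding the node x with a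
weight proportional to the reproducing kernel of the span at x. *)
Definition kaczmarz_update (x : T) (d : nat -> nat -> R) (k s : nat) : R :=
  d k s - (span_part d k x + tail_part k x) * f s x / christoffel x.

(** With g = p + h the value of the error at x, the square expands into
- 2 g p + g^2 = h^2 - p^2, so the gain p^2 comes from the part of the error in
the span and the loss h^2 from the part outside it. *)
Lemma kaczmarz_update_sqr x d k : christoffel x != 0 ->
  \sum_(s <- S) kaczmarz_update x d k s ^+ 2 =
  \sum_(s <- S) d k s ^+ 2 +
  (tail_part k x ^+ 2 - span_part d k x ^+ 2) / christoffel x.
Proof.
move=> w0; rewrite /kaczmarz_update.
set p := span_part d k x; set h := tail_part k x.
have wE : \sum_(s <- S) f s x ^+ 2 = christoffel x by [].
set w := christoffel x in w0 wE *.
under eq_bigr => s _.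
  rewrite (_ : _ ^+ 2 = d k s ^+ 2 - 2 * ((p + h) / w) * (d k s * f s x) +
    ((p + h) / w) ^+ 2 * f s x ^+ 2); last by field.
  over.
rewrite big_split/= sumrB -!mulr_sumr -/(span_part d k x) -/p wE.
by field.
Qed.

(** The Cauchy-Schwarz inequality, which keeps the gain finite at every node. *)
Lemma span_part_sqr_le x d k : christoffel x != 0 ->
  span_part d k x ^+ 2 <= christoffel x * \sum_(s <- S) d k s ^+ 2.
Proof.
move=> w0; have wge0 : 0 <= christoffel x by apply: sumr_ge0 => s _; exact: sqr_ge0.
have wgt0 : 0 < christoffel x by rewrite lt_def w0.
have : 0 <= \sum_(s <- S) (d k s - span_part d k x * f s x / christoffel x) ^+ 2.
  by apply: sumr_ge0 => s _; exact: sqr_ge0.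
set p := span_part d k x; set w := christoffel x.
have wE : \sum_(s <- S) f s x ^+ 2 = w by [].
under eq_bigr => s _.
  rewrite (_ : _ ^+ 2 = d k s ^+ 2 - 2 * (p / w) * (d k s * f s x) +
    (p / w) ^+ 2 * f s x ^+ 2); last by field.
  over.
rewrite big_split/= sumrB -!mulr_sumr -/(span_part d k x) -/p wE.
rewrite (_ : _ + _ = \sum_(s <- S) d k s ^+ 2 - p ^+ 2 / w); last by field.
by rewrite subr_ge0 ler_pdivrMr// mulrC.
Qed.

Let mf i : measurable_fun D (f i). Proof. exact: f_orth.1. Qed.

Lemma measurable_christoffel : measurable_fun D christoffel.
Proof. by apply: measurable_sum => s; exact/measurable_funX. Qed.

Lemma measurable_span_part d k : measurable_fun D (span_part d k).
Proof. by apply: measurable_sum => s; apply: measurable_funM. Qed.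

Lemma measurable_tail_part k : measurable_fun D (tail_part k).
Proof. exact: measurable_funM. Qed.

Lemma integral_christoffel :
  (\int[mu]_(x in D) (christoffel x)%:E)%E = (size S)%:R%:E.
Proof.
under eq_integral do rewrite /christoffel -sumEFin.
rewrite ge0_integral_sum//.
- under eq_bigr => s _.
    under eq_integral do rewrite expr2.
    rewrite f_orth.2 eqxx; over.
  by rewrite sumEFin big_const_seq count_predT iter_addr_0.
- by move=> s; apply/measurable_EFinP/measurable_funX.
- by move=> s x _; rewrite lee_fin sqr_ge0.
Qed.

Lemma integral_tail_part k :
  (\int[mu]_(x in D) (tail_part k x ^+ 2)%:E)%E = (k \notin S)%:R%:E.
Proof.
rewrite /tail_part; case: (k \notin S) => /=.
  under eq_integral do rewrite mul1r expr2.
  by rewrite f_orth.2 eqxx.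
by under eq_integral do rewrite mul0r expr0n; rewrite integral0.
Qed.

Lemma integral_span_part d k :
  (\int[mu]_(x in D) (span_part d k x ^+ 2)%:E)%E =
  (\sum_(s <- S) d k s ^+ 2)%:E.
Proof. exact: (parseval mD f_orth). Qed.

Lemma integral_weighted_series (g : nat -> T -> R) (v : nat -> R) (a : R) :
  (forall k, measurable_fun D (g k)) -> 0 <= a ->
  (forall k, (\int[mu]_(x in D) (g k x ^+ 2)%:E)%E = (v k)%:E) ->
  (\int[mu]_(x in D) (\sum_(0 <= k <oo) (c k * g k x ^+ 2)%:E +
     (a * christoffel x)%:E))%E =
  (\sum_(0 <= k <oo) (c k * v k)%:E + (a * (size S)%:R)%:E)%E.
Proof.
move=> mg a0 gv.
have mcg k : measurable_fun D (fun x => (c k * g k x ^+ 2)%:E).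
  by apply/measurable_EFinP/measurable_funM => //; exact/measurable_funX.
have cg0 k x : D x -> (0 <= (c k * g k x ^+ 2)%:E)%E.
  by move=> _; rewrite lee_fin mulr_ge0// sqr_ge0.
rewrite ge0_integralD//; last 4 first.
- by move=> x Dx; apply: nneseries_ge0 => k _ _; exact: cg0.
- by apply: ge0_emeasurable_sum => // k x Dx _; exact: cg0.
- move=> x _; rewrite lee_fin mulr_ge0//.
  by apply: sumr_ge0 => s _; exact: sqr_ge0.
- by apply/measurable_EFinP/measurable_funM => //; exact: measurable_christoffel.
congr (_ + _)%E.
  rewrite integral_nneseries//; apply: eq_eseriesr => k _.
  under eq_integral do rewrite EFinM.
  rewrite ge0_integralZl// ?gv//.
  - by apply/measurable_EFinP/measurable_funX.
  - by move=> x _; rewrite lee_fin sqr_ge0.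
  - by rewrite lee_fin.
under eq_integral do rewrite EFinM.
rewrite ge0_integralZl// ?integral_christoffel//.
- by apply/measurable_EFinP; exact: measurable_christoffel.
- by move=> x _; rewrite lee_fin; apply: sumr_ge0 => s _; exact: sqr_ge0.
Qed.

(** Compare the loss plus (e / m) w with the gain plus (t / m) w, m being the
size of S: both functions integrate to e + t, so at some x with w(x) > 0 the
first is at most the second, and dividing by w(x) gives the claim. *)
Lemma kaczmarz_step (d : nat -> nat -> R) (e t : R) :
  energy d = e%:E -> tail_energy = t%:E ->
  exists2 x, D x & (energy (kaczmarz_update x d) <=
    ((1 - (size S)%:R^-1) * e + (size S)%:R^-1 * t)%:E)%E.
Proof.
move=> dE tE.
have m0 : 0 < (size S)%:R :> R by rewrite ltr0n.
set m := (size S)%:R in m0 *.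
have sum_ge0 (g : nat -> R) : (forall k, 0 <= g k) ->
    (0 <= \sum_(0 <= k <oo) (c k * g k)%:E)%E.
  by move=> g0; apply: nneseries_ge0 => k _ _; rewrite lee_fin mulr_ge0.
have e0 : 0 <= e.
  rewrite -lee_fin -dE; apply: sum_ge0 => k.
  by apply: sumr_ge0 => s _; exact: sqr_ge0.
have t0 : 0 <= t by rewrite -lee_fin -tE; apply: sum_ge0.
have ge0w x : 0 <= christoffel x by apply: sumr_ge0 => s _; exact: sqr_ge0.
have em0 : 0 <= e / m by rewrite divr_ge0// ltW.
have tm0 : 0 <= t / m by rewrite divr_ge0// ltW.
pose F x := (\sum_(0 <= k <oo) (c k * tail_part k x ^+ 2)%:E +
     (e / m * christoffel x)%:E)%E.
pose G x := (\sum_(0 <= k <oo) (c k * span_part d k x ^+ 2)%:E +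
     (t / m * christoffel x)%:E)%E.
have mser (g : nat -> T -> R) (a : R) : (forall k, measurable_fun D (g k)) ->
    measurable_fun D (fun x => \sum_(0 <= k <oo) (c k * g k x ^+ 2)%:E +
      (a * christoffel x)%:E)%E.
  move=> mg; apply: emeasurable_funD.
    apply: ge0_emeasurable_sum => // k.
      by move=> x _ _; rewrite lee_fin mulr_ge0// sqr_ge0.
    by move=> _; apply/measurable_EFinP/measurable_funM => //; exact/measurable_funX.
  by apply/measurable_EFinP/measurable_funM => //; exact: measurable_christoffel.
have [x [Dx wx FGx]] : exists x, [/\ D x, christoffel x != 0 & (F x <= G x)%E].
  apply: (@exists_le_of_integral_le R dT T mu D F G christoffel mD).
  - by apply: mser => k; exact: measurable_tail_part.
  - by apply: mser => k; exact: measurable_span_part.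
  - exact: measurable_christoffel.
  - move=> x _; apply: adde_ge0; first by apply: sum_ge0 => k; exact: sqr_ge0.
    by rewrite lee_fin mulr_ge0// divr_ge0// ltW.
  - move=> x _; apply: adde_ge0; first by apply: sum_ge0 => k; exact: sqr_ge0.
    by rewrite lee_fin mulr_ge0// divr_ge0// ltW.
  - move=> x _ wx; rewrite /G wx mulr0 adde0 eseries0// => k _ _.
    rewrite /span_part big1_seq ?expr0n ?mulr0// => s /andP[_ sS].
    have /eqP : \sum_(s <- S) f s x ^+ 2 = 0 by [].
    rewrite psumr_eq0; last by move=> ? _; exact: sqr_ge0.
    by move=> /allP/(_ _ sS); rewrite sqrf_eq0 => /eqP ->; rewrite mulr0.
  - rewrite (integral_weighted_series measurable_tail_part _ integral_tail_part)//.
    rewrite (integral_weighted_series (measurable_span_part d) _ (integral_span_part d))//.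
    rewrite -/tail_energy tE -/(energy d) dE -/m !divfK ?gt_eqF//.
    by rewrite addeC.
  - rewrite (integral_weighted_series (measurable_span_part d) _ (integral_span_part d))//.
    by rewrite -/(energy d) dE -EFinD ltry.
  - by rewrite integral_christoffel eqe -/m gt_eqF.
exists x => //.
have w0 : 0 < christoffel x by rewrite lt_def wx ge0w.
set w := christoffel x in wx FGx w0 *.
pose p := (\sum_(0 <= k <oo) (c k * span_part d k x ^+ 2)%:E)%E.
pose h := (\sum_(0 <= k <oo) (c k * tail_part k x ^+ 2)%:E)%E.
have p0 : (0 <= p)%E by apply: sum_ge0 => k; exact: sqr_ge0.
have h0 : (0 <= h)%E by apply: sum_ge0 => k; exact: sqr_ge0.
have pfin : p \is a fin_num.
  rewrite ge0_fin_numE//.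
  apply: (@le_lt_trans _ _ (w%:E * energy d)%E); last by rewrite dE ltry.
  rewrite /energy -nneseriesZl; last first.
    move=> k _; rewrite lee_fin mulr_ge0// sumr_ge0// => s _; exact: sqr_ge0.
  apply: lee_nneseries => [k _ _|k _]; first by rewrite lee_fin mulr_ge0 // sqr_ge0.
  by rewrite -EFinM lee_fin [leRHS]mulrCA ler_wpM2l// span_part_sqr_le.
have hfin : h \is a fin_num.
  rewrite ge0_fin_numE//; apply: (@le_lt_trans _ _ (F x)).
    by rewrite /F leeDl// lee_fin mulr_ge0// divr_ge0// ltW.
  by rewrite (le_lt_trans FGx)// /G -/p -(fineK pfin) ltry.
have key : (energy (kaczmarz_update x d) + w^-1%:E * p =
            e%:E + w^-1%:E * h)%E.
  have cg0 (g : nat -> T -> R) k : (0 <= (c k * g k x ^+ 2)%:E)%E.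
    by rewrite lee_fin mulr_ge0// sqr_ge0.
  have wcg0 (g : nat -> T -> R) k : (0 <= w^-1%:E * (c k * g k x ^+ 2)%:E)%E.
    by rewrite mule_ge0// lee_fin invr_ge0 ltW.
  rewrite /p /h -!nneseriesZl//.
  have ge0d (d' : nat -> nat -> R) (k : nat) : (0 <= (c k * \sum_(s <- S) d' k s ^+ 2)%:E)%E.
    by rewrite lee_fin mulr_ge0// sumr_ge0// => s _; exact: sqr_ge0.
  rewrite -dE /energy -!nneseriesD//.
  apply: eq_eseriesr => k _; rewrite -!EFinM -!EFinD kaczmarz_update_sqr// -/w; congr EFin.
  by field.
have ufin : energy (kaczmarz_update x d) \is a fin_num.
  rewrite ge0_fin_numE; last first.
    by apply: sum_ge0 => k; apply: sumr_ge0 => s _; exact: sqr_ge0.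
  apply: (@le_lt_trans _ _ (energy (kaczmarz_update x d) + w^-1%:E * p)%E).
    by rewrite leeDl// mule_ge0// lee_fin invr_ge0 ltW.
  by rewrite key -(fineK hfin) ltry.
move: FGx key; rewrite /F /G -/p -/h -(fineK pfin) -(fineK hfin) -(fineK ufin).
rewrite -!EFinM -!EFinD !lee_fin => FGx [key].
have -> : fine (energy (kaczmarz_update x d)) = e + w^-1 * (fine h - fine p).
  by rewrite mulrBr addrA -key addrK.
have : w^-1 * (fine h - fine p) <= w^-1 * ((t / m - e / m) * w).
  apply: ler_wpM2l; first by rewrite invr_ge0 ltW.
  by move: FGx; rewrite -/w mulrBl; lra.
rewrite (_ : w^-1 * (_ * w) = t / m - e / m); last by field; rewrite wx gt_eqF.
by lra.
Qed.

End kaczmarz_step.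

Section kaczmarz_algorithm.
Context {R : realType} {dT} {T : measurableType dT}
  (mu : {measure set T -> \bar R}) (D : set T) (mD : measurable D)
  (f : nat -> T -> R) (f_orth : orthonormal_on mu D f).
Variables (c : nat -> R) (S : seq nat).
Hypotheses (c_ge0 : forall k, 0 <= c k) (uS : uniq S) (S_gt0 : (0 < size S)%N).

Definition span_fun n (b : 'I_n -> nat -> R) (l : 'I_n) (x : T) : R :=
  \sum_(s <- S) b l s * f s x.

Definition error_coef n (tau : 'I_n -> T) (b : 'I_n -> nat -> R) (k s : nat) : R :=
  (k == s)%:R - \sum_(l < n) f k (tau l) * b l s.

Lemma sum_delta_uniq (F : nat -> R) k :
  \sum_(s <- S) (k == s)%:R * F s = (k \in S)%:R * F k.
Proof.
have [kS|kS] := boolP (k \in S).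
  rewrite (bigD1_seq k)//= eqxx big1 ?addr0// => s sk.
  by rewrite eq_sym (negbTE sk) mul0r.
rewrite mul0r big1_seq// => s /andP[_ sS].
by have [ks|] := eqVneq k s; [rewrite ks sS in kS|rewrite mul0r].
Qed.

(** Links the operator form of the error to its coefficients, which are all that
the iteration acts on. *)
Lemma residual_expansion n (tau : 'I_n -> T) (b : 'I_n -> nat -> R) k x :
  f k x - \sum_(l < n) f k (tau l) * span_fun b l x =
  span_part f S (error_coef tau b) k x + tail_part f S k x.
Proof.
rewrite /span_part /tail_part /error_coef.
under [X in _ = X + _]eq_bigr do rewrite mulrBl mulr_suml.
rewrite sumrB sum_delta_uniq exchange_big/=.
rewrite [X in _ = _ - X + _](_ : _ = \sum_(l < n) f k (tau l) * span_fun b l x).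
  by case: (k \in S) => /=; rewrite ?mul1r ?mul0r ?addr0 ?sub0r 1?addrC.
by apply: eq_bigr => l _; rewrite /span_fun mulr_sumr; apply: eq_bigr => s _; rewrite mulrA.
Qed.

Lemma integral_residual_sqr n (tau : 'I_n -> T) (b : 'I_n -> nat -> R) k :
  (\int[mu]_(x in D)
     ((f k x - \sum_(l < n) f k (tau l) * span_fun b l x) ^+ 2)%:E)%E =
  ((k \notin S)%:R + \sum_(s <- S) error_coef tau b k s ^+ 2)%:E.
Proof.
under eq_integral do rewrite residual_expansion.
rewrite /tail_part; have [kS|kS] := boolP (k \in S).
  rewrite add0r -(parseval mD f_orth _ uS).
  by under eq_integral do rewrite mul0r addr0.
pose a s := if s == k then 1 else error_coef tau b k s.
have aE (F : R -> nat -> R) : \sum_(s <- S) F (a s) s = \sum_(s <- S) F (error_coef tau b k s) s.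
  apply: eq_big_seq => s sS; rewrite /a; have [sk|//] := eqVneq s k.
  by rewrite sk (negbTE kS) in sS.
transitivity (\int[mu]_(x in D) ((\sum_(s <- k :: S) a s * f s x) ^+ 2)%:E)%E.
  apply: eq_integral => x _; rewrite big_cons (aE (fun u s => u * f s x)).
  by rewrite /a eqxx addrC.
rewrite (parseval mD f_orth _)/= ?kS// big_cons (aE (fun u s => u ^+ 2)).
by rewrite /a eqxx expr1n.
Qed.

(** A step changes the weights of the earlier nodes too, since the correction
uses the error of the current approximation at the new node; the result is again
a linear algorithm with weights in the span. *)
Lemma kaczmarz_nodes (W t : R) (n : nat) :
  (\sum_(0 <= k <oo) (c k)%:E)%E = W%:E -> tail_energy c S = t%:E ->
  exists (tau : 'I_n -> T) (b : 'I_n -> nat -> R),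
    (forall l, D (tau l)) /\
    (energy c S (error_coef tau b) <=
       ((1 - (size S)%:R^-1) ^+ n * W + t)%:E)%E.
Proof.
move=> WE tE.
have t0 : 0 <= t.
  rewrite -lee_fin -tE; apply: nneseries_ge0 => k _ _.
  by rewrite lee_fin mulr_ge0.
have m0 : 0 < (size S)%:R :> R by rewrite ltr0n.
have m1 : 1 <= (size S)%:R :> R by rewrite ler1n.
have mi : 0 <= 1 - (size S)%:R^-1 :> R by rewrite subr_ge0 invf_le1.
have energy_ge0 d : (0 <= energy c S d)%E.
  apply: nneseries_ge0 => k _ _; rewrite lee_fin mulr_ge0// sumr_ge0// => s _.
  exact: sqr_ge0.
elim: n => [|n [tau [b [Dtau IH]]]].
  exists (fun=> point), (fun _ _ => 0); split; first by case.
  rewrite expr0 mul1r; apply: (@le_trans _ _ W%:E); last by rewrite lee_fin lerDl.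
  rewrite -WE; apply: lee_nneseries => k _.
    by rewrite lee_fin mulr_ge0// sumr_ge0// => s _; exact: sqr_ge0.
  rewrite lee_fin -[leRHS]mulr1 ler_wpM2l//.
  rewrite (_ : \sum_(s <- S) _ = (k \in S)%:R); first by case: (k \in S).
  rewrite -[RHS]mulr1 -(sum_delta_uniq (fun=> 1)); apply: eq_bigr => s _.
  by rewrite /error_coef big_ord0 subr0 mulr1; case: (k == s); rewrite ?expr1n ?expr0n.
have efin : energy c S (error_coef tau b) \is a fin_num.
  by rewrite ge0_fin_numE// (le_lt_trans IH)// ltry.
have [x Dx xle] := kaczmarz_step mD f_orth c_ge0 uS S_gt0 (esym (fineK efin)) tE.
pose g s := f s x / christoffel f S x.
(* The new node gets the number 0, the earlier ones are shifted. *)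
pose tau' i := oapp tau x (unlift (@ord0 n) i).
pose b' i s := oapp (fun l => b l s - span_fun b l x * g s) (g s) (unlift (@ord0 n) i).
exists tau', b'; split.
  by move=> l; rewrite /tau'; case: unliftP => [j|] _ //=; exact: Dtau.
have -> : energy c S (error_coef tau' b') =
    energy c S (kaczmarz_update f S x (error_coef tau b)).
  apply: eq_eseriesr => k _; congr (_ * _)%:E; apply: eq_bigr => s _; congr (_ ^+ 2).
  rewrite /kaczmarz_update -residual_expansion -mulrA -/(g s).
  rewrite {1}/error_coef big_ord_recl /tau' /b' unlift_none /=.
  under eq_bigr do rewrite liftK /= mulrBr mulrA.
  rewrite sumrB -mulr_suml /error_coef; ring.
apply: (le_trans xle); rewrite lee_fin.
move: IH; rewrite -(fineK efin) lee_fin => /(ler_wpM2l mi).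
rewrite exprS mulrDr mulrA; lra.
Qed.

Lemma kaczmarz_algorithm (W t : R) (n : nat) :
  (\sum_(0 <= k <oo) (c k)%:E)%E = W%:E -> tail_energy c S = t%:E ->
  exists (tau : 'I_n -> T) (b : 'I_n -> nat -> R),
    (forall l, D (tau l)) /\
    (\sum_(0 <= k <oo) (c k)%:E * \int[mu]_(x in D)
       ((f k x - \sum_(l < n) f k (tau l) * span_fun b l x) ^+ 2)%:E <=
     ((1 - (size S)%:R^-1) ^+ n * W + 2 * t)%:E)%E.
Proof.
move=> WE tE; have [tau [b [Dtau tb]]] := kaczmarz_nodes n WE tE.
exists tau, b; split => //.
under eq_eseriesr do rewrite integral_residual_sqr -EFinM mulrDr EFinD.
rewrite nneseriesD; last 2 first.
- by move=> k _ _; rewrite lee_fin mulr_ge0.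
- by move=> k _ _; rewrite lee_fin mulr_ge0// sumr_ge0// => s _; exact: sqr_ge0.
rewrite -/(tail_energy c S) -/(energy c S _) tE.
apply: (le_trans (leeD2l _ tb)); rewrite -EFinD lee_fin; lra.
Qed.

End kaczmarz_algorithm.

(** * Tensor products of an orthonormal system on the unit cube *)

Section tensor_integral.
Context {R : realType}.
Local Notation Rb := (measurableTypeR R).

Lemma integral_prod_fun {d1 d2} {T1 : measurableType d1} {T2 : measurableType d2}
    (m1 : {sigma_finite_measure set T1 -> \bar R})
    (m2 : {sigma_finite_measure set T2 -> \bar R})
    (g : T1 -> R) (h : T2 -> R) (a b : R) :
  m1.-integrable setT (EFin \o g) -> m2.-integrable setT (EFin \o h) ->
  (\int[m1]_x (g x)%:E = a%:E)%E -> (\int[m2]_x (h x)%:E = b%:E)%E ->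
  (m1 \x m2)%E.-integrable setT (EFin \o (fun z => g z.1 * h z.2)) /\
  (\int[(m1 \x m2)%E]_z (g z.1 * h z.2)%:E = (a * b)%:E)%E.
Proof.
move=> ig ih ga hb.
have mg : measurable_fun setT g by exact/measurable_EFinP/(measurable_int _ ig).
have mh : measurable_fun setT h by exact/measurable_EFinP/(measurable_int _ ih).
have int_gh : (m1 \x m2)%E.-integrable setT (EFin \o (fun z => g z.1 * h z.2)).
  apply/integrable12ltyP.
    apply/measurable_EFinP/measurable_funM.
      exact: (measurableT_comp mg measurable_fst).
    exact: (measurableT_comp mh measurable_snd).
  have /integrableP[_ hoo] := ih; have /integrableP[_ goo] := ig.
  rewrite (_ : integral _ _ _ =
      (\int[m1]_x `|(g x)%:E| * \int[m2]_y `|(h y)%:E|)%E).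
    by rewrite lte_mul_pinfty ?integral_ge0// ge0_fin_numE// integral_ge0.
  rewrite -ge0_integralZr ?integral_ge0//.
  - apply: eq_integral => x _ /=.
    rewrite -ge0_integralZl//.
    + by apply: eq_integral => y _; rewrite normrM EFinM.
    + by apply/measurable_EFinP/measurableT_comp.
  - by apply/measurable_EFinP/measurableT_comp.
split => //.
rewrite -integral12_prod_meas1// /fubini_F /=.
transitivity (\int[m1]_x (b%:E * (g x)%:E))%E.
  apply: eq_integral => x _.
  under eq_integral do rewrite EFinM.
  by rewrite integralZl// hb muleC.
by rewrite integralZl// ga -EFinM mulrC.
Qed.

(** Fubini's theorem, one coordinate at a time along the recursive definition of
the measure. *)
Lemma integral_tensor d (G : 'I_d -> Rb -> R) (a : 'I_d -> R) :
  (forall l, (@lebesgue_measure R).-integrable setT (EFin \o G l)) ->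
  (forall l, (\int[@lebesgue_measure R]_x (G l x)%:E = (a l)%:E)%E) ->
  (lebesgue_tuple d).-integrable setT
    (EFin \o (fun t => \prod_(l < d) G l (tnth t l))) /\
  (\int[lebesgue_tuple d]_t (\prod_(l < d) G l (tnth t l))%:E =
    (\prod_(l < d) a l)%:E)%E.
Proof.
elim: d G a => [|d IH] G a iG Ga.
  have E : (fun t : 0.-tuple Rb => \prod_(l < 0) G l (tnth t l)) = cst 1.
    by apply/funext => t; rewrite big_ord0.
  have mc1 (f : 0.-tuple Rb -> \bar R) : f = cst 1%E -> measurable_fun setT f.
    by move=> ->; exact: measurable_cst.
  split.
    rewrite E; apply/integrableP; split; first exact: (mc1 _ erefl).
    rewrite /= integral_dirac//=.
    by rewrite diracT mul1e ltry.
  under eq_integral do rewrite big_ord0.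
  by rewrite big_ord0 /= integral_dirac//= diracT mul1e.
have [iH eH] := IH (fun l => G (lift ord0 l)) (fun l => a (lift ord0 l))
  (fun l => iG _) (fun l => Ga _).
have [iP eP] := integral_prod_fun (iG ord0) iH (Ga ord0) eH.
have E : (fun z : Rb * d.-tuple Rb => G ord0 z.1 * \prod_(l < d) G (lift ord0 l) (tnth z.2 l)) =
  (fun t => \prod_(l < d.+1) G l (tnth t l)) \o @tuple_consf R d.
  apply/funext => -[x t] /=; rewrite big_ord_recl/= tnth0; congr (_ * _).
  by apply: eq_bigr => l _; rewrite tnthS.
have mF : measurable_fun setT (EFin \o (fun t : d.+1.-tuple Rb => \prod_(l < d.+1) G l (tnth t l))).
  apply/measurable_EFinP; apply: measurable_prod => l _.
  have mG : measurable_fun setT (G l).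
    by apply/measurable_EFinP; exact: (measurable_int _ (iG l)).
  exact: (measurableT_comp mG (measurable_tnth l)).
have mc := @measurable_tuple_consf R d.
have iF : (lebesgue_tuple d.+1).-integrable setT
    (EFin \o (fun t => \prod_(l < d.+1) G l (tnth t l))).
  by apply: (integrable_pushforward mc mF) => //; rewrite -compA -E.
split => //=.
rewrite /lebesgue_tupleS integral_pushforward//=; last by rewrite -compA -E.
rewrite big_ord_recl -eP; apply: eq_integral => z _ /=.
by have /(congr1 (@^~ z)) /= <- := E.
Qed.
End tensor_integral.

Section tensor_orthonormal.
Context {R : realType}.
Local Notation Rb := (measurableTypeR R).
Variables (phi : nat -> Rb -> R) (d : nat).
Hypothesis phi_on : orthonormal_system phi.

Definition tensor (k : d.-tuple nat) (t : d.-tuple Rb) : R :=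
  \prod_(l < d) phi (tnth k l) (tnth t l).

Lemma measurable_unit_cube : measurable (unit_cube d : set (d.-tuple Rb)).
Proof.
rewrite (_ : unit_cube d = \bigcap_(l in [set: 'I_d])
    (@tnth d Rb ^~ l) @^-1` `[0, 1]%classic).
  apply: fin_bigcap_measurable => // l _.
  by rewrite -[X in measurable X]setTI; exact: measurable_tnth.
apply/seteqP; split=> t /= tA l; first by move=> _; rewrite /= in_itv/=; exact: tA.
by have := tA l I; rewrite /= in_itv.
Qed.

Lemma orthonormal_system_on :
  orthonormal_on (@lebesgue_measure R) (`[0, 1]%classic : set Rb) phi.
Proof. exact: phi_on. Qed.

Lemma tensor_measurable k : measurable_fun (unit_cube d) (tensor k).
Proof.
apply: measurable_prod => l _.
apply: (measurable_comp (F := `[0, 1]%classic : set Rb)).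
- exact: measurable_itv.
- by move=> _ [t tc <-] /=; rewrite in_itv/=; exact: tc.
- exact: phi_on.1.
- exact: (measurable_funTS (measurable_tnth l)).
Qed.

Lemma tensor_orthonormal (j k : d.-tuple nat) :
  (\int[lebesgue_tuple d]_(t in unit_cube d) (tensor j t * tensor k t)%:E)%E =
  (j == k)%:R%:E.
Proof.
pose G (l : 'I_d) : Rb -> R :=
  (fun x => phi (tnth j l) x * phi (tnth k l) x) \_ (`[0, 1]%classic : set Rb).
have [||_ eG] := @integral_tensor R d G (fun l => (tnth j l == tnth k l)%:R).
- move=> l; rewrite /G -restrict_EFin.
  have mI : measurable (`[0, 1]%classic : set Rb) by exact: measurable_itv.
  have := orthonormal_integrable mI orthonormal_system_on
    (tnth j l) (tnth k l).
  by move/(integrable_mkcond _ mI).1.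
- move=> l; have := phi_on.2 (tnth j l) (tnth k l); rewrite integral_mkcond => <-.
  by apply: eq_integral => x _; rewrite /G !patchE; case: ifPn.
transitivity (\prod_(l < d) ((tnth j l == tnth k l)%:R : R))%:E; last first.
  congr EFin; have [->|jk] := eqVneq j k; first by rewrite big1// => l _; rewrite eqxx.
  have [l jkl] : exists l, tnth j l != tnth k l.
    apply/existsP; rewrite -negb_forall; apply: contra jk => /forallP jk.
    by apply/eqP/eq_from_tnth => l; exact/eqP.
  by rewrite (bigD1 l)//= (negbTE jkl) mul0r.
rewrite -eG integral_mkcond; apply: eq_integral => t _.
rewrite patchE; case: ifPn => [/set_mem tc|/negP tc].
  rewrite -big_split/=; congr EFin; apply: eq_bigr => l _.
  by rewrite /G patchE mem_set//= in_itv/=; exact: tc.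
have [l tl] : exists l, ~~ (0 <= tnth t l <= 1).
  by apply/existsP; rewrite -negb_forall; apply/negP => /forallP tl; apply/tc/mem_set.
by rewrite (bigD1 l)//= /G patchE memNset ?mul0r//= in_itv/=; exact/negP.
Qed.

Lemma tensor_orthonormal_on (e : nat -> d.-tuple nat) : injective e ->
  orthonormal_on (lebesgue_tuple d) (unit_cube d) (fun n => tensor (e n)).
Proof.
move=> e_inj; split=> [n|i j]; first exact: tensor_measurable.
by rewrite tensor_orthonormal (inj_eq e_inj).
Qed.

End tensor_orthonormal.

(** * From the random field to its eigenfunctions *)

Lemma sum_le_nneseries {R : realType} (F : nat -> R) (S : seq nat) :
  uniq S -> (forall k, 0 <= F k) ->
  ((\sum_(s <- S) F s)%:E <= \sum_(0 <= k <oo) (F k)%:E)%E.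
Proof.
move=> uS F0.
have [m Sm] : exists m, forall s, s \in S -> (s < m)%N.
  exists (\max_(s <- S) s).+1 => s sS; rewrite ltnS.
  by rewrite (big_rem s)//= leq_maxl.
apply: le_trans (nneseries_lim_ge m _); last by move=> k _ _; rewrite lee_fin.
rewrite sumEFin lee_fin.
rewrite (perm_big [seq i <- index_iota 0 m | i \in S]) /=; last first.
  apply: uniq_perm => //; first by rewrite filter_uniq// iota_uniq.
  move=> i; rewrite mem_filter mem_index_iota /=.
  by case: (boolP (i \in S)) => //= iS; rewrite Sm.
by rewrite big_filter big_mkcond/= ler_sum// => i _; case: ifP.
Qed.

(** Sum the inequalities v_i v_j <= (v_i^2 + v_j^2) / 2 over all pairs. *)
Lemma sqr_sum_le {R : realType} n (v : 'I_n -> R) :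
  (\sum_(i < n) v i) ^+ 2 <= n%:R * \sum_(i < n) v i ^+ 2.
Proof.
rewrite expr2 mulr_suml.
under eq_bigr do rewrite mulr_sumr.
have -> : n%:R * \sum_(i < n) v i ^+ 2 =
    \sum_(i < n) \sum_(j < n) ((v i ^+ 2 + v j ^+ 2) / 2).
  under [RHS]eq_bigr => i _ do rewrite -mulr_suml big_split/= sumr_const card_ord.
  rewrite -mulr_suml big_split/= sumr_const card_ord sumrMnl.
  by set s := \sum_(i < n) _; rewrite -(mulr_natl s); field.
apply: ler_sum => i _; apply: ler_sum => j _.
have := sqr_ge0 (v i - v j); lra.
Qed.

Section mean_square.
Context {R : realType} {d : nat} {dOmega : measure_display}
  {Omega : measurableType dOmega} {P : probability Omega R}.
Local Notation Rb := (measurableTypeR R).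
Variables (lambda : nat -> R) (phi : nat -> Rb -> R)
  (xi : d.-tuple nat -> {RV P >-> R}) (X : d.-tuple Rb -> Omega -> R).
Hypotheses (xi_uncorrelated : uncorrelated_standard xi)
  (X_field : tensor_product_field lambda phi xi X).
Variables (e : nat -> d.-tuple nat) (g : d.-tuple nat -> nat).
Hypotheses (eK : cancel e g) (gK : cancel g e).

Definition eigen_scale (k : d.-tuple nat) : R := \prod_(l < d) lambda (tnth k l).

(** Lets Parseval's identity apply to random variables as it does to functions. *)
Lemma uncorrelated_orthonormal :
  orthonormal_on P setT (fun n => xi (e n) : Omega -> R).
Proof.
have [E0 V1 C0] := xi_uncorrelated.
have covE i j : covariance P (xi i) (xi j) = (\int[P]_w (xi i w * xi j w)%:E)%E.
  rewrite covariance.unlock !E0 /= expectation.unlock.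
  by apply: eq_integral => w _ /=; rewrite -[in RHS](subr0 (xi i w)) -[in RHS](subr0 (xi j w)).
split=> [i|i j]; first exact: measurable_funP.
rewrite -covE; have [->|ij] := eqVneq i j; first exact: V1.
by rewrite C0// (inj_eq (can_inj eK)).
Qed.

Lemma field_measurable t : unit_cube d t -> measurable_fun setT (X t).
Proof.
move=> ut.
have mD : measurable (unit_cube d `*` [set: Omega] : set (d.-tuple Rb * Omega)).
  by apply: measurableX => //; exact: measurable_unit_cube.
have sub : pair t @` [set: Omega] `<=` unit_cube d `*` [set: Omega].
  by move=> _ [w _ <-].
exact: (measurable_comp mD sub (field_jointly_measurable X_field) (pair1_measurable t)).
Qed.

Definition cube_indices (N : nat) : seq nat :=
  [seq g (map_tuple (@nat_of_ord N) k) | k <- enum {: d.-tuple 'I_N}].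

Lemma cube_indices_uniq N : uniq (cube_indices N).
Proof.
rewrite map_inj_uniq ?enum_uniq// => j k /(can_inj gK) /(congr1 val) /=.
by move=> /(inj_map val_inj) /val_inj.
Qed.

Lemma tensor_partial_sumE N t w :
  tensor_partial_sum lambda phi xi N t w =
  \sum_(s <- cube_indices N)
    eigen_scale (e s) * tensor phi (e s) t * xi (e s) w.
Proof.
rewrite /cube_indices big_map big_enum /=; apply: eq_bigr => k _.
rewrite gK /eigen_scale /tensor; congr (_ * _ * _).
  by apply: eq_bigr => l _; rewrite tnth_map.
by apply: eq_bigr => l _; rewrite tnth_map.
Qed.

Lemma tensor_partial_sum_measurable N t :
  measurable_fun setT (tensor_partial_sum lambda phi xi N t).
Proof.
rewrite (_ : tensor_partial_sum lambda phi xi N t = fun w => \sum_(s <- cube_indices N)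
    eigen_scale (e s) * tensor phi (e s) t * xi (e s) w); last first.
  by apply/funext => w; exact: tensor_partial_sumE.
by apply: measurable_sum => s; exact: measurable_funM.
Qed.

(** Replacing X by a partial sum of its expansion costs an error that tends to 0
in mean square at each of the finitely many points t_l.  The second moment of
the combination of the partial sums is computed by Parseval's identity.  The
factor 2 comes from separating these two contributions. *)
Lemma mean_square_combination_le m (y : 'I_m -> R) (t : 'I_m -> d.-tuple Rb) :
  (forall l, unit_cube d (t l)) ->
  (\int[P]_w ((\sum_(l < m) y l * X (t l) w) ^+ 2)%:E <=
   2%:E * \sum_(0 <= n <oo) (eigen_scale (e n) ^+ 2 *
      (\sum_(l < m) y l * tensor phi (e n) (t l)) ^+ 2)%:E)%E.
Proof.
move=> ut.
set Q := (\sum_(0 <= n <oo) _)%E.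
pose Y N t w := tensor_partial_sum lambda phi xi N t w.
pose Delta N l := (\int[P]_w ((X (t l) w - Y N (t l) w) ^+ 2)%:E)%E.
have mX l : measurable_fun setT (X (t l)) by exact: field_measurable.
have mY N l : measurable_fun setT (Y N (t l)) by exact: tensor_partial_sum_measurable.
have bound N : (\int[P]_w ((\sum_(l < m) y l * X (t l) w) ^+ 2)%:E <=
    \sum_(l < m) (2 * m%:R * y l ^+ 2)%:E * Delta N l + 2%:E * Q)%E.
  have partial : (\int[P]_w ((\sum_(l < m) y l * Y N (t l) w) ^+ 2)%:E <= Q)%E.
    rewrite (_ : integral _ _ _ = (\sum_(s <- cube_indices N)
       (eigen_scale (e s) * \sum_(l < m) y l * tensor phi (e s) (t l)) ^+ 2)%:E).
      under eq_bigr do rewrite exprMn.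
      apply: (sum_le_nneseries (F := fun n => eigen_scale (e n) ^+ 2 *
        (\sum_(l < m) y l * tensor phi (e n) (t l)) ^+ 2)).
        exact: cube_indices_uniq.
      by move=> k; rewrite mulr_ge0 ?sqr_ge0.
    rewrite -(parseval (mu := P) measurableT uncorrelated_orthonormal) ?cube_indices_uniq//.
    apply: eq_integral => w _; congr (_ ^+ 2)%:E.
    rewrite /Y; under eq_bigr do rewrite tensor_partial_sumE mulr_sumr.
    rewrite exchange_big/=; apply: eq_bigr => s _.
    by rewrite mulr_sumr mulr_suml; apply: eq_bigr => l _; ring.
  have mD l : measurable_fun setT (fun w => ((X (t l) w - Y N (t l) w) ^+ 2)%:E).
    by apply/measurable_EFinP/measurable_funX/measurable_funB.
  have mZ : measurable_fun setT (fun w => ((\sum_(l < m) y l * Y N (t l) w) ^+ 2)%:E).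
    apply/measurable_EFinP/measurable_funX.
    by apply: measurable_sum => l; exact: measurable_funM.
  apply: (@le_trans _ _ (\int[P]_w (\sum_(l < m) (2 * m%:R * y l ^+ 2)%:E *
      ((X (t l) w - Y N (t l) w) ^+ 2)%:E +
      2%:E * ((\sum_(l < m) y l * Y N (t l) w) ^+ 2)%:E))%E).
    apply: ge0_le_integral => //.
    - by move=> w _; rewrite lee_fin sqr_ge0.
    - apply/measurable_EFinP/measurable_funX.
      by apply: measurable_sum => l; exact: measurable_funM.
    - apply: emeasurable_funD; last exact: measurable_funeM.
      by apply: emeasurable_sum => l; exact: measurable_funeM.
    - move=> w _; under [X in (_ <= X + _)%E]eq_bigr do rewrite -EFinM.
      rewrite -EFinM sumEFin -EFinD lee_fin.
      set z := \sum_(l < m) y l * Y N (t l) w.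
      have -> : \sum_(l < m) y l * X (t l) w =
          \sum_(l < m) y l * (X (t l) w - Y N (t l) w) + z.
        by rewrite -big_split/=; apply: eq_bigr => l _; ring.
      have := sqr_sum_le (fun l => y l * (X (t l) w - Y N (t l) w)).
      under [X in _ <= _ * X -> _]eq_bigr do rewrite exprMn.
      set a := \sum_(l < m) _ * (_ - _); rewrite mulr_sumr => ale.
      have -> : \sum_(l < m) 2 * m%:R * y l ^+ 2 * (X (t l) w - Y N (t l) w) ^+ 2 =
          2 * \sum_(l < m) m%:R * (y l ^+ 2 * (X (t l) w - Y N (t l) w) ^+ 2).
        by rewrite mulr_sumr; apply: eq_bigr => l _; rewrite !mulrA.
      have := sqr_ge0 (a - z); lra.
  rewrite ge0_integralD//; last 4 first.
  - move=> w _; apply: sume_ge0 => l _; rewrite mule_ge0// lee_fin ?sqr_ge0//.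
    by rewrite mulr_ge0// sqr_ge0.
  - by apply: emeasurable_sum => l; exact: measurable_funeM.
  - by move=> w _; rewrite mule_ge0// lee_fin sqr_ge0.
  - exact: measurable_funeM.
  apply: leeD.
    rewrite ge0_integral_sum//; last 2 first.
    - by move=> l; exact: measurable_funeM.
    - by move=> l w _; rewrite mule_ge0// lee_fin ?sqr_ge0// mulr_ge0// sqr_ge0.
    apply: lee_sum => l _; rewrite ge0_integralZl//.
    - by move=> w _; rewrite lee_fin sqr_ge0.
    - by rewrite lee_fin mulr_ge0// sqr_ge0.
  rewrite ge0_integralZl//; first exact: lee_wpmul2l.
  by move=> w _; rewrite lee_fin sqr_ge0.
have lim0 : (\sum_(l < m) (2 * m%:R * y l ^+ 2)%:E * Delta N l + 2%:E * Q)%E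
    @[N --> \oo] --> (0 + 2%:E * Q)%E.
  have Q0 : (0 <= Q)%E.
    by apply: nneseries_ge0 => k _ _; rewrite lee_fin mulr_ge0 ?sqr_ge0.
  have sum0 : (\sum_(l < m) (2 * m%:R * y l ^+ 2)%:E * Delta N l)%E
      @[N --> \oo] --> 0%E.
    rewrite [X in _ --> X](_ : 0%E = \sum_(l < m) (0 : \bar R))%E; last by rewrite big1.
    apply: cvg_nnesum => l _.
      apply: nearW => N; rewrite mule_ge0//.
        by rewrite lee_fin mulr_ge0// sqr_ge0.
      by apply: integral_ge0 => w _; rewrite lee_fin sqr_ge0.
    rewrite -[X in _ --> X](mule0 (2 * m%:R * y l ^+ 2)%:E); apply: cvgeZl => //.
    have := field_expansion X_field (ut l).
    by rewrite expectation.unlock.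
  apply: (cvgeD _ sum0); last exact: cvg_cst.
  by rewrite fin_num_adde_defr.
rewrite -[leRHS]add0e; apply: (cvge_ge _ lim0).
by apply: nearW => N; exact: bound.
Qed.
End mean_square.

Section algorithm_error.
Context {R : realType} {d : nat} {dOmega : measure_display}
  {Omega : measurableType dOmega} {P : probability Omega R}.
Local Notation Rb := (measurableTypeR R).
Variables (lambda : nat -> R) (phi : nat -> Rb -> R)
  (xi : d.-tuple nat -> {RV P >-> R}) (X : d.-tuple Rb -> Omega -> R).
Hypotheses (phi_on : orthonormal_system phi)
  (xi_uncorrelated : uncorrelated_standard xi)
  (X_field : tensor_product_field lambda phi xi X).
Variables (e : nat -> d.-tuple nat) (g : d.-tuple nat -> nat).
Hypotheses (eK : cancel e g) (gK : cancel g e).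

(** Tonelli's theorem lets the expectation act at a fixed point t.  There the
error is the linear combination of X(t) and the X(tau_l) with coefficients 1 and
- psi_l(t), to which the second moment bound applies; integrating the resulting
series term by term over the cube gives the squared norms. *)
Lemma integral_square_error_le n (tau : 'I_n -> d.-tuple Rb)
    (psi : 'I_n -> d.-tuple Rb -> R) :
  (forall l, unit_cube d (tau l)) ->
  (forall l, measurable_fun (unit_cube d) (psi l)) ->
  (\int[P]_w sqnormL2
     (fun t => X t w - \sum_(l < n) X (tau l) w * psi l t)%R <=
   2%:E * \sum_(0 <= k <oo) (eigen_scale lambda (e k) ^+ 2)%:E *
     \int[lebesgue_tuple d]_(t in unit_cube d)
       ((tensor phi (e k) t - \sum_(l < n) tensor phi (e k) (tau l) * psi l t)
          ^+ 2)%:E)%E.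
Proof.
move=> utau mpsi.
have mcube := @measurable_unit_cube R d.
pose Z t w := X t w - \sum_(l < n) X (tau l) w * psi l t.
pose D : set (d.-tuple Rb * Omega) := unit_cube d `*` [set: Omega].
have mD : measurable D by exact: measurableX.
have mZ : measurable_fun D (fun tw : d.-tuple Rb * Omega => Z tw.1 tw.2).
  apply: measurable_funB; first exact: (field_jointly_measurable X_field).
  apply: measurable_sum => l; apply: measurable_funM.
    apply: (measurableT_comp (field_measurable X_field (utau l))).
    exact: measurable_funTS measurable_snd.
  apply: (measurable_comp (F := unit_cube d)) => //.
    by move=> _ [[t w] [/= tc _] <-].
  exact: measurable_funTS measurable_fst.
pose G := (fun tw : d.-tuple Rb * Omega => ((Z tw.1 tw.2) ^+ 2)%:E) \_ D.
have mG : measurable_fun setT G.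
  by apply: (measurable_restrictT _ mD).1; apply/measurable_EFinP/measurable_funX.
have G0 tw : (0 <= G tw)%E.
  by rewrite /G patchE; case: ifP => // _; rewrite lee_fin sqr_ge0.
have GE t w : G (t, w) = ((fun t => (Z t w ^+ 2)%:E) \_ (unit_cube d)) t.
  rewrite /G !patchE /D; case: ifPn => [/set_mem[tc _]|tc].
    by rewrite mem_set.
  by rewrite memNset// => tc'; move/negP: tc; apply; apply/mem_set; split.
have -> : (\int[P]_w sqnormL2 (Z ^~ w) =
    \int[lebesgue_tuple d]_(t in unit_cube d) \int[P]_w (Z t w ^+ 2)%:E)%E.
  rewrite /sqnormL2 [RHS]integral_mkcond.
  under [LHS]eq_integral => w _.
    rewrite integral_mkcond.
    under eq_integral do rewrite -GE.
    over.
  rewrite -(@fubini_tonelli _ _ _ _ _ (lebesgue_tuple d) P G mG G0).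
  apply: eq_integral => t _; rewrite [RHS]patchE.
  case: ifPn => tc.
    by apply: eq_integral => w _; rewrite GE patchE tc.
  under eq_integral do rewrite GE patchE (negbTE tc).
  exact: integral0.
pose err k t := tensor phi (e k) t - \sum_(l < n) tensor phi (e k) (tau l) * psi l t.
have mten k : measurable_fun (unit_cube d) (tensor phi k).
  exact: tensor_measurable.
have merr k : measurable_fun (unit_cube d) (err k).
  by apply: measurable_funB => //; apply: measurable_sum => l; exact: measurable_funM.
have mterm k : measurable_fun (unit_cube d)
    (fun t => (eigen_scale lambda (e k) ^+ 2 * err k t ^+ 2)%:E).
  by apply/measurable_EFinP/measurable_funM => //; exact: measurable_funX.
have term0 k t : (0 <= (eigen_scale lambda (e k) ^+ 2 * err k t ^+ 2)%:E)%E.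
  by rewrite lee_fin mulr_ge0// sqr_ge0.
have mser : measurable_fun (unit_cube d) (fun t =>
    \sum_(0 <= k <oo) (eigen_scale lambda (e k) ^+ 2 * err k t ^+ 2)%:E)%E.
  by apply: ge0_emeasurable_sum => // k t _ _.
apply: (@le_trans _ _ (\int[lebesgue_tuple d]_(t in unit_cube d)
   (2%:E * \sum_(0 <= k <oo) (eigen_scale lambda (e k) ^+ 2 * err k t ^+ 2)%:E))%E).
  apply: ge0_le_integral => //.
  - by move=> t _; apply: integral_ge0 => w _; rewrite lee_fin sqr_ge0.
  - apply: (eq_measurable_fun (fubini_F P G)).
      move=> t /set_mem tc; apply: eq_integral => w _.
      by rewrite GE patchE mem_set.
    by apply: measurable_funTS; exact: measurable_fun_fubini_tonelli_F.
  - exact: measurable_funeM.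
  - move=> t tc.
    (* The point t itself is the node number 0, with coefficient 1. *)
    pose y i := oapp (fun l => - psi l t) 1 (unlift (@ord0 n) i).
    pose u i := oapp tau t (unlift (@ord0 n) i).
    have uu i : unit_cube d (u i).
      by rewrite /u; case: unliftP => [j|] _ //=; exact: utau.
    have := mean_square_combination_le xi_uncorrelated X_field eK gK y uu.
    have yuE (F : d.-tuple Rb -> R) :
      \sum_(i < n.+1) y i * F (u i) = F t - \sum_(l < n) F (tau l) * psi l t.
      rewrite big_ord_recl /y /u unlift_none /= mul1r -sumrN; congr (_ + _).
      by apply: eq_bigr => l _; rewrite liftK /= mulNr mulrC.
    under eq_integral do rewrite (yuE (X ^~ _)).
    by under eq_eseriesr do rewrite yuE.
rewrite ge0_integralZl//; last by move=> t _; apply: nneseries_ge0.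
rewrite integral_nneseries//.
rewrite lee_wpmul2l//; apply: lee_nneseries => [k _ _|k _].
  by apply: integral_ge0.
under eq_integral do rewrite EFinM.
rewrite ge0_integralZl//.
- by apply/measurable_EFinP/measurable_funX.
- by move=> t _; rewrite lee_fin sqr_ge0.
- by rewrite lee_fin sqr_ge0.
Qed.
End algorithm_error.

Section field_algorithm.
Context {R : realType} {d : nat} {dOmega : measure_display}
  {Omega : measurableType dOmega} {P : probability Omega R}.
Local Notation Rb := (measurableTypeR R).
Variables (lambda : nat -> R) (phi : nat -> Rb -> R)
  (xi : d.-tuple nat -> {RV P >-> R}) (X : d.-tuple Rb -> Omega -> R).
Hypotheses (phi_on : orthonormal_system phi)
  (xi_uncorrelated : uncorrelated_standard xi)
  (X_field : tensor_product_field lambda phi xi X).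
Variables (e : nat -> d.-tuple nat) (g : d.-tuple nat -> nat).
Hypotheses (eK : cancel e g) (gK : cancel g e).

Lemma exists_algorithm (S : seq nat) (W t : R) (n : nat) :
  uniq S -> (0 < size S)%N ->
  (\sum_(0 <= k <oo) (eigen_scale lambda (e k) ^+ 2)%:E)%E = W%:E ->
  tail_energy (fun k => eigen_scale lambda (e k) ^+ 2) S = t%:E ->
  exists A : linear_algorithm d n,
    (\int[P]_w sqnormL2
       (fun t => X t w - eval_algorithm A (X ^~ w) t)%R <=
     (2 * ((1 - (size S)%:R^-1) ^+ n * W + 2 * t))%:E)%E.
Proof.
move=> uS S0 WE tE.
have mcube := @measurable_unit_cube R d.
have ten_on := tensor_orthonormal_on phi_on (can_inj eK).
have c0 k : 0 <= eigen_scale lambda (e k) ^+ 2 by exact: sqr_ge0.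
have [tau [b [utau err]]] := kaczmarz_algorithm mcube ten_on c0 uS S0 n WE tE.
pose psi := span_fun (fun k => tensor phi (e k)) S b.
have mpsi l : measurable_fun (unit_cube d) (psi l).
  by apply: measurable_sum => s; apply: measurable_funM => //; exact: tensor_measurable.
have psiL2 l : in_L2 (psi l).
  split; first exact: mpsi.
  by rewrite /sqnormL2 /psi /span_fun (parseval mcube ten_on)// ltry.
exists (LinearAlgorithm utau psiL2).
apply: (le_trans (integral_square_error_le phi_on xi_uncorrelated X_field eK gK utau mpsi)).
by rewrite EFinM lee_wpmul2l.
Qed.
End field_algorithm.

(** * Powers against exponentials *)

Section powers.
Context {R : realType}.
Implicit Types (x y a b s rho : R) (j k n p : nat).

Lemma powRE x s : 0 < x -> x `^ s = expR (s * ln x).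
Proof. by move=> x0; rewrite /powR gt_eqF. Qed.

(** Both signs of s are covered at once: the constant a^s + b^s dominates whichever
of the two endpoints is the extremal one. *)
Lemma powR_le_comparable a b s : 0 < a -> 0 < b -> exists2 C : R, 0 < C &
  forall x y, 0 < y -> a * y <= x -> x <= b * y -> x `^ s <= C * y `^ s.
Proof.
move=> a0 b0; exists (a `^ s + b `^ s); first by rewrite addr_gt0// powR_gt0.
move=> x y y0 ax xb.
have x0 : 0 < x by rewrite (lt_le_trans _ ax)// mulr_gt0.
have lnay : ln a + ln y <= ln x by rewrite -lnM ?posrE// ler_ln ?posrE// mulr_gt0.
have lnby : ln x <= ln b + ln y by rewrite -lnM ?posrE// ler_ln ?posrE// mulr_gt0.
rewrite !powRE// mulrDl -!expRD.
have [s0|s0] := leP 0 s.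
  apply: ler_wpDl; first exact: expR_ge0.
  by rewrite ler_expR -mulrDr ler_wpM2l.
apply: ler_wpDr; first exact: expR_ge0.
by rewrite ler_expR -mulrDr ler_wnM2l// ltW.
Qed.

(** The tangent of the logarithm at a; the freedom in a makes the slope as small as
desired. *)
Lemma ln_le_linear x a : 0 < x -> 0 < a -> ln x <= x / a - 1 + ln a.
Proof.
move=> x0 a0; rewrite -lerBlDr -ln_div ?posrE//.
have xa : 0 < x / a by rewrite divr_gt0.
have -> : x / a = 1 + (x / a - 1) by rewrite addrC subrK.
by rewrite [leRHS]addrAC subrr add0r; apply: le_ln1Dx; rewrite ltrBDl addrN.
Qed.

Lemma powR_le_geometric a s : 1 < a -> exists2 C : R, 0 < C &
  forall k, k.+1%:R `^ s <= C * a ^+ k.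
Proof.
move=> a1; have a0 : 0 < a by exact: lt_trans a1.
have lna : 0 < ln a by rewrite ln_gt0.
have [s0|s0] := leP s 0.
  exists 1 => // k; rewrite mul1r (@le_trans _ _ 1)//.
    by rewrite powRE// expR_le1 mulr_le0_ge0// ln_ge0// ler1n.
  by rewrite exprn_ege1// ltW.
exists (expR (ln a - s + s * ln (s / ln a))); first exact: expR_gt0.
move=> k; have sl : 0 < s / ln a by rewrite divr_gt0.
have k0 : 0 < k.+1%:R :> R by [].
rewrite powRE// -{3}(lnK (x := a)) ?posrE// -expRM_natl -expRD ler_expR.
have := ler_wpM2l (ltW s0) (ln_le_linear k0 sl).
set u := ln (s / ln a); rewrite (_ : s * (_ + u) = k.+1%:R * ln a - s + s * u); last first.
  by field; rewrite !gt_eqF.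
by rewrite -natr1; lra.
Qed.

Lemma geometric_sum_le rho n : 0 <= rho < 1 ->
  \sum_(k < n) rho ^+ k <= (1 - rho)^-1.
Proof.
move=> /andP[r0 r1]; have r1' : 0 < 1 - rho by rewrite subr_gt0.
rewrite -[leRHS]mul1r ler_pdivlMr// mulrC -opprB mulNr -subrX1 opprB.
by rewrite gerBl exprn_ge0.
Qed.

Lemma poly_geometric_sum_le rho s : 0 < rho < 1 -> exists2 C : R, 0 < C &
  forall n, \sum_(k < n) rho ^+ k * k.+1%:R `^ s <= C.
Proof.
move=> /andP[r0 r1].
have a1 : 1 < (1 + rho^-1) / 2 by have := invf_gt1 r0; rewrite r1; lra.
have [C C0 leC] := powR_le_geometric s a1.
set a := _ / 2 in a1 leC.
have ra : rho * a = (1 + rho) / 2 by rewrite /a; field; rewrite gt_eqF.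
exists (C * (1 - rho * a)^-1).
  by rewrite mulr_gt0// invr_gt0 ra; lra.
move=> n; apply: (@le_trans _ _ (C * \sum_(k < n) (rho * a) ^+ k)).
  rewrite mulr_sumr; apply: ler_sum => k _.
  by rewrite exprMn mulrCA ler_wpM2l ?exprn_ge0 ?leC// ltW.
by rewrite ler_wpM2l ?(ltW C0)// geometric_sum_le// ra; apply/andP; split; lra.
Qed.

(** Peetre's inequality: changing the argument by k changes a power by at most a
power of k + 1, so that polynomial factors are almost constant on the scale of
the geometric ones in the sums below. *)
Lemma peetre j k s :
  (j + k).+1%:R `^ s <= j.+1%:R `^ s * k.+1%:R `^ `|s| :> R /\
  j.+1%:R `^ s <= (j + k).+1%:R `^ s * k.+1%:R `^ `|s| :> R.
Proof.
have j0 : 0 < j.+1%:R :> R by []; have k0 : 0 < k.+1%:R :> R by [].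
have jk0 : 0 < (j + k).+1%:R :> R by [].
have le1 : ln j.+1%:R <= ln (j + k).+1%:R :> R.
  by rewrite ler_ln ?posrE// ler_nat ltnS leq_addr.
have le2 : ln (j + k).+1%:R <= ln j.+1%:R + ln k.+1%:R :> R.
  rewrite -lnM ?posrE// ler_ln ?posrE// -?natrM ?ltr0n// ler_nat.
  by rewrite mulSn -addnS addnC leq_add2l leq_pmulr.
have lk : 0 <= ln k.+1%:R :> R by rewrite ln_ge0// ler1n.
rewrite !powRE// -!expRD !ler_expR.
have [s0|s0] := leP 0 s; [rewrite ger0_norm//|rewrite ltr0_norm//]; split; nra.
Qed.

(** The last term dominates: read backwards, the sum is a convergent geometric
series with a polynomial factor. *)
Lemma sum_geometric_poly_below s : exists2 C : R, 0 < C &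
  forall p, \sum_(k < p.+1) 2 ^+ k * k.+1%:R `^ s <= C * (2 ^+ p * p.+1%:R `^ s) :> R.
Proof.
have [|C C0 leC] := @poly_geometric_sum_le 2^-1 `|s|; first by apply/andP; split; lra.
exists C => // p; apply: (@le_trans _ _ (2 ^+ p * p.+1%:R `^ s *
    \sum_(k < p.+1) 2^-1 ^+ k * k.+1%:R `^ `|s|)); last first.
  by rewrite mulrC ler_wpM2r// mulr_ge0// ?exprn_ge0// powR_ge0.
rewrite (reindex_inj rev_ord_inj)/= mulr_sumr; apply: ler_sum => k _.
rewrite subSS; have kp : (k <= p)%N by rewrite -ltnS.
have [_] := peetre (p - k) k s; rewrite subnK// => le.
rewrite mulrACA.
have -> : (2 : R) ^+ p * 2^-1 ^+ k = 2 ^+ (p - k).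
  by rewrite -{1}(subnK kp) exprD -mulrA -exprMn divff ?pnatr_eq0// expr1n mulr1.
by rewrite ler_wpM2l// exprn_ge0.
Qed.

Lemma sum_geometric_poly_above rho s : 0 < rho < 1 -> exists2 C : R, 0 < C &
  forall p n, \sum_(k < n) rho ^+ (p + k) * (p + k).+1%:R `^ s <=
    C * (rho ^+ p * p.+1%:R `^ s).
Proof.
move=> r01; have [C C0 leC] := poly_geometric_sum_le `|s| r01.
have /andP[/ltW r0 _] := r01.
exists C => // p n; apply: (@le_trans _ _ (rho ^+ p * p.+1%:R `^ s *
    \sum_(k < n) rho ^+ k * k.+1%:R `^ `|s|)); last first.
  by rewrite mulrC ler_wpM2r// mulr_ge0// ?exprn_ge0// powR_ge0.
rewrite mulr_sumr; apply: ler_sum => k _.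
by rewrite mulrACA -exprD ler_wpM2l ?exprn_ge0//; have [] := peetre p k s.
Qed.

End powers.

(** * Discrete convolutions of powers *)

Section convolution.
Context {R : realType}.
Implicit Types (a b s : R) (j k n p : nat).

(** A discrete form of the derivative of ln, replacing the comparison of sums with
integrals. *)
Lemma ln_succ_gap j : (0 < j)%N -> ln j%:R + j.+1%:R^-1 <= ln j.+1%:R :> R.
Proof.
move=> j0; have j1 : 0 < j.+1%:R :> R by [].
have jR : 0 < j%:R :> R by rewrite ltr0n.
have x1 : j.+1%:R^-1 < 1 :> R by rewrite invf_lt1// ltr1n.
have : ln (1 + - j.+1%:R^-1) <= - j.+1%:R^-1 :> R by apply: le_ln1Dx; rewrite ltrN2.
rewrite (_ : 1 + - j.+1%:R^-1 = j%:R / j.+1%:R :> R); last first.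
  by rewrite -natr1; field; rewrite natr1 pnatr_eq0.
rewrite ln_div ?posrE//; set x := j.+1%:R^-1.
by move=> lnx; rewrite -lerBrDr -(lerD2r (- ln j.+1%:R)) addrAC subrr add0r.
Qed.

Lemma powR_succ_div a j : j.+1%:R `^ (a + 1) / j.+1%:R = j.+1%:R `^ a :> R.
Proof.
rewrite powRD; last by rewrite pnatr_eq0 implybT.
by rewrite powRr1// mulfK// pnatr_eq0.
Qed.

(** Each term is bounded by a multiple of the increment of j^(a+1), and the
increments telescope. *)
Lemma sum_powR_le a : -1 < a -> exists2 C : R, 0 < C &
  forall n, \sum_(j < n) j.+1%:R `^ a <= C * n%:R `^ (a + 1).
Proof.
move=> a1; set s := a + 1; have s0 : 0 < s by rewrite /s; lra.
have C0 : 0 < (1 + s) / s by rewrite divr_gt0// addr_gt0.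
exists ((1 + s) / s) => //; elim=> [|n IH].
  by rewrite big_ord0 mulr_ge0 ?powR_ge0// ltW.
rewrite big_ord_recr/= -[leRHS](subrKC ((1 + s) / s * n%:R `^ s)).
apply: lerD => //; rewrite -mulrBr -powR_succ_div -/s.
have [->|n0] := posnP n.
  rewrite powR0 ?gt_eqF// powR1 subr0 mulr1 invr1 ler_pdivlMr//; lra.
have N0 : 0 < n.+1%:R :> R by [].
set x := n.+1%:R^-1; have x0 : 0 < x by rewrite invr_gt0.
have x1 : x <= 1 by rewrite invf_le1// ler1n.
have le1 : n%:R `^ s <= n.+1%:R `^ s / (1 + s * x).
  rewrite powRE ?ltr0n// powRE// ler_pdivlMr ?addr_gt0 ?mulr_gt0//.
  apply: (@le_trans _ _ (expR (s * ln n%:R) * expR (s * x))).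
    by rewrite ler_wpM2l ?expR_ge0// expR_ge1Dx.
  rewrite -expRD ler_expR -mulrDr; apply: ler_wpM2l; first exact: ltW.
  exact: ln_succ_gap.
set y := n.+1%:R `^ s in le1 *; have y0 : 0 <= y by exact: powR_ge0.
apply: (@le_trans _ _ ((1 + s) / s * (y - y / (1 + s * x)))); last first.
  by apply: ler_wpM2l; rewrite ?(ltW C0)// lerB.
have sx0 : 0 < 1 + s * x by rewrite addr_gt0// mulr_gt0.
have -> : (1 + s) / s * (y - y / (1 + s * x)) = y * x * ((1 + s) / (1 + s * x)).
  by field; rewrite !gt_eqF.
rewrite -[leLHS]mulr1; apply: ler_wpM2l; first by rewrite mulr_ge0// ltW.
by rewrite ler_pdivlMr// mul1r lerD2l ler_piMr// ltW.
Qed.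

(** Here j^(a+1) decreases, so the telescoping sum stays bounded. *)
Lemma sum_powR_bounded a : a < -1 -> exists2 C : R, 0 < C &
  forall n, \sum_(j < n) j.+1%:R `^ a <= C.
Proof.
move=> a1; set s := - (a + 1); have s0 : 0 < s by rewrite /s; lra.
have aE : a + 1 = - s by rewrite /s opprK.
have si0 : 0 < s^-1 by rewrite invr_gt0.
exists (1 + s^-1); first by rewrite addr_gt0.
suff H n : \sum_(j < n.+1) j.+1%:R `^ a <= 1 + s^-1 * (1 - n.+1%:R `^ (- s)).
  case=> [|n]; first by rewrite big_ord0 addr_ge0// ltW.
  apply: (le_trans (H n)); rewrite lerD2l ler_piMr ?(ltW si0)//.
elim: n => [|n IH]; first by rewrite big_ord1 !powR1 subrr mulr0 addr0.
rewrite big_ord_recr/= -[1 - n.+2%:R `^ _](subrKA (n.+1%:R `^ (- s))).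
rewrite mulrDr addrA; apply: lerD => //.
rewrite -powR_succ_div aE.
have N0 : 0 < n.+2%:R :> R by [].
set x := n.+2%:R^-1; have x0 : 0 < x by rewrite invr_gt0.
have : n.+2%:R `^ (- s) * (1 + s * x) <= n.+1%:R `^ (- s).
  rewrite !powRE//; apply: (@le_trans _ _ (expR (- s * ln n.+2%:R) * expR (s * x))).
    by rewrite ler_wpM2l ?expR_ge0// expR_ge1Dx.
  rewrite -expRD ler_expR; have := ln_succ_gap (ltn0Sn n); rewrite -/x => lnx.
  have := ler_wpM2l (ltW s0) lnx; lra.
set y := n.+2%:R `^ _; set z := n.+1%:R `^ _ => le1.
by rewrite [leRHS]mulrC ler_pdivlMr//; lra.
Qed.

(** In each term one of the two arguments is at least (p+1)/2, and the power of that
argument is comparable with the same power of p+1. *)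
Lemma convolution_powR_split a b : exists2 C : R, 0 < C & forall p,
  \sum_(j < p.+1) j.+1%:R `^ a * (p - j).+1%:R `^ b <=
  C * (p.+1%:R `^ b * \sum_(j < p.+1) j.+1%:R `^ a +
       p.+1%:R `^ a * \sum_(j < p.+1) j.+1%:R `^ b).
Proof.
have h0 : 0 < 2^-1 :> R by lra.
have [Ca Ca0 leCa] := powR_le_comparable a h0 ltr01.
have [Cb Cb0 leCb] := powR_le_comparable b h0 ltr01.
exists (Ca + Cb); first exact: addr_gt0.
move=> p.
have rev : \sum_(j < p.+1) j.+1%:R `^ b = \sum_(j < p.+1) (p - j).+1%:R `^ b.
  by rewrite (reindex_inj rev_ord_inj)/=; apply: eq_bigr => j _; rewrite subSS.
rewrite rev !mulr_sumr -big_split/= mulr_sumr; apply: ler_sum => j _.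
have jp : (j <= p)%N by rewrite -ltnS.
have p0 : 0 < p.+1%:R :> R by [].
have ge0 (u v : nat) c1 c2 : 0 <= u%:R `^ c1 * v%:R `^ c2 :> R.
  by rewrite mulr_ge0// powR_ge0.
have [pj|pj] := leqP p (2 * j).
  have : j.+1%:R `^ a <= Ca * p.+1%:R `^ a.
    apply: leCa => //; last by rewrite mul1r ler_nat ltnS.
    rewrite mulrC ler_pdivrMr// -natrM ler_nat mulnC; lia.
  move/(ler_wpM2r (powR_ge0 (p - j).+1%:R b)).
  by have := ge0 p.+1 j.+1 b a; have := ge0 p.+1 (p - j).+1 a b; nra.
have : (p - j).+1%:R `^ b <= Cb * p.+1%:R `^ b.
  apply: leCb => //; last by rewrite mul1r ler_nat ltnS leq_subr.
  rewrite mulrC ler_pdivrMr// -natrM ler_nat mulnC; lia.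
move/(ler_wpM2l (powR_ge0 j.+1%:R a)).
by have := ge0 p.+1 j.+1 b a; have := ge0 p.+1 (p - j).+1 a b; nra.
Qed.

Lemma convolution_powR_gt a b : -1 < a -> -1 < b -> exists2 C : R, 0 < C &
  forall p, \sum_(j < p.+1) j.+1%:R `^ a * (p - j).+1%:R `^ b <=
    C * p.+1%:R `^ (a + b + 1).
Proof.
move=> a1 b1; have [C C0 leC] := convolution_powR_split a b.
have [Ca Ca0 leCa] := sum_powR_le a1; have [Cb Cb0 leCb] := sum_powR_le b1.
exists (C * (Ca + Cb)); first by rewrite mulr_gt0// addr_gt0.
move=> p; apply: (le_trans (leC p)); rewrite -mulrA; apply: ler_wpM2l; first exact: ltW.
have pN0 c d : (c + d == 0 :> R) ==> (p.+1%:R != 0 :> R) by rewrite pnatr_eq0 implybT.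
have -> : (Ca + Cb) * p.+1%:R `^ (a + b + 1) =
    p.+1%:R `^ b * (Ca * p.+1%:R `^ (a + 1)) + p.+1%:R `^ a * (Cb * p.+1%:R `^ (b + 1)).
  by rewrite !powRD//; ring.
by apply: lerD; apply: ler_wpM2l; rewrite ?powR_ge0.
Qed.

Lemma convolution_powR_lt a : a < -1 -> exists2 C : R, 0 < C &
  forall p, \sum_(j < p.+1) j.+1%:R `^ a * (p - j).+1%:R `^ a <=
    C * p.+1%:R `^ a.
Proof.
move=> a1; have [C C0 leC] := convolution_powR_split a a.
have [Ca Ca0 leCa] := sum_powR_bounded a1.
exists (C * (Ca + Ca)); first by rewrite mulr_gt0// addr_gt0.
move=> p; apply: (le_trans (leC p)); rewrite -mulrA; apply: ler_wpM2l; first exact: ltW.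
rewrite -mulrDr mulrC; apply: ler_wpM2r; first exact: powR_ge0.
by apply: lerD.
Qed.

End convolution.

(** * Blocks of size 2^p (p+1)^gamma *)

Section block.
Context {R : realType}.
Implicit Types (D x gamma : R) (p : nat).

Definition block_size D gamma p : R := D * 2 ^+ p * p.+1%:R `^ gamma.

Lemma block_size_gt0 D gamma p : 0 < D -> 0 < block_size D gamma p.
Proof. by move=> D0; rewrite /block_size !mulr_gt0// ?exprn_gt0// powR_gt0. Qed.

Lemma ln_block_size D gamma p : 0 < D ->
  ln (block_size D gamma p) = ln D + p%:R * ln 2 + gamma * ln p.+1%:R.
Proof.
move=> D0; rewrite /block_size lnM ?posrE ?mulr_gt0 ?exprn_gt0 ?powR_gt0//.
by rewrite lnM ?posrE ?exprn_gt0// lnXn// ln_powR mulr_natl.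
Qed.

Lemma block_size_step D gamma p : 0 < D ->
  block_size D gamma p.+1 <= 2 * 2 `^ `|gamma| * block_size D gamma p.
Proof.
move=> D0; have [+ _] := @peetre R p 1 gamma; rewrite addn1 => le.
rewrite /block_size exprS.
have c0 : 0 <= D * (2 * 2 ^+ p) by rewrite mulr_ge0 ?(ltW D0)// mulr_ge0// exprn_ge0.
apply: (le_trans (ler_wpM2l c0 le)).
by rewrite le_eqVlt; apply/orP; left; apply/eqP; ring.
Qed.

(** The logarithm of the power of p+1 is absorbed, whatever the sign of gamma, by half
of the linear term p ln 2. *)
Lemma ln_block_size_ge D gamma : 0 < D -> exists2 c : R, 0 <= c &
  forall p, ln 2 / 2 * p%:R - c <= ln (block_size D gamma p).
Proof.
move=> D0; have l2 : 0 < ln 2 :> R by rewrite ln_gt0// ltr1n.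
(* With this tangent point the slope `|gamma| / t is at most ln 2 / 2. *)
pose t : R := 2 * (`|gamma| + 1) / ln 2.
have t0 : 0 < t by rewrite /t divr_gt0// mulr_gt0// ltr_wpDl.
exists (`|ln D| + ln 2 + `|gamma| * `|ln t|).
  by rewrite !addr_ge0 ?mulr_ge0// ltW.
move=> p; rewrite ln_block_size//.
have p0 : 0 < p.+1%:R :> R by [].
have le1 : `|gamma| * ln p.+1%:R <= ln 2 / 2 * p.+1%:R + `|gamma| * `|ln t|.
  apply: (le_trans (ler_wpM2l (normr_ge0 gamma) (ln_le_linear p0 t0))).
  have le2 : `|gamma| * (p.+1%:R / t) <= ln 2 / 2 * p.+1%:R.
    have -> : `|gamma| * (p.+1%:R / t) =
        `|gamma| / (`|gamma| + 1) * (ln 2 / 2 * p.+1%:R).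
      by rewrite /t; field; rewrite !gt_eqF// ltr_wpDl.
    rewrite -[leRHS]mul1r; apply: ler_wpM2r.
      by rewrite mulr_ge0// divr_ge0// ltW.
    by rewrite ler_pdivrMr ?ltr_wpDl// mul1r lerDl.
  have := ler_wpM2l (normr_ge0 gamma) (ler_norm (ln t)).
  have := normr_ge0 gamma; move: le2; set u := p.+1%:R / t; lra.
have lp : 0 <= ln p.+1%:R :> R by rewrite ln_ge0// ler1n.
have := ler_wpM2r lp (lerNnormlW (lexx `|gamma|)).
have := lerNnormlW (lexx `|ln D|).
by move: le1; rewrite -natr1; lra.
Qed.

(** For x >= 1 the least p with x <= block_size D gamma p works: by minimality
x exceeds the preceding block size, which is comparable, and then ln x is
comparable with p. *)
Lemma block_cover D gamma : 0 < D ->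
  exists a b : R, [/\ 0 < a, 0 < b & forall x, 1 <= x -> exists p,
    [/\ x <= block_size D gamma p,
        p = 0 \/ block_size D gamma p <= 2 * 2 `^ `|gamma| * x,
        a * p.+1%:R <= 1 + ln x & 1 + ln x <= b * p.+1%:R]].
Proof.
move=> D0; have l2 : 0 < ln 2 :> R by rewrite ln_gt0// ltr1n.
have [c c0 lec] := ln_block_size_ge gamma D0.
set h : R := ln 2 / 2 in lec; have h0 : 0 < h by rewrite divr_gt0.
pose A := h^-1 + c / h + 2.
have hi : 0 <= h^-1 by rewrite invr_ge0 ltW.
have chi : 0 <= c / h by rewrite mulr_ge0.
have A1 : 2 <= A by rewrite /A ler_wpDl// addr_ge0.
have A0 : 0 < A by lra.
exists A^-1, (1 + `|ln D| + ln 2 + `|gamma|); split.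
- by rewrite invr_gt0.
- by rewrite -addrA addr_gt0 ?ltr_wpDr// ltr_wpDr// ltr_wpDl.
move=> x x1; have x0 : 0 < x by lra.
have lx : 0 <= ln x by rewrite ln_ge0.
have ex : exists p, x <= block_size D gamma p.
  exists (Num.truncn ((ln x + c) / h)).+1.
  rewrite -ler_ln ?posrE ?block_size_gt0//; apply: le_trans (lec _).
  rewrite lerBrDr mulrC -ler_pdivrMr//; apply/ltW.
  by apply: truncnS_gt.
have [p px minp] := ex_minnP ex.
exists p; split=> //.
- case: p px minp => [|p] px minp; [by left|right].
  have ltx : block_size D gamma p < x.
    by rewrite ltNge; apply/negP => /minp; rewrite ltnn.
  apply: (le_trans (block_size_step _ _ D0)); apply: ler_wpM2l; last exact: ltW.
  by rewrite mulr_ge0// powR_ge0.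
- rewrite mulrC ler_pdivrMr//.
  case: p px minp => [|p] px minp.
    by have := mulr_ge0 lx (ltW A0); rewrite mulrDl; lra.
  have ltx : ln (block_size D gamma p) < ln x.
    rewrite ltr_ln ?posrE ?block_size_gt0//.
    by rewrite ltNge; apply/negP => /minp; rewrite ltnn.
  have : h * p%:R <= ln x + c by have := lec p; lra.
  rewrite mulrC -ler_pdivlMr// => lep.
  have -> : p.+2%:R = p%:R + 2 :> R by rewrite -addn2 natrD.
  apply: (@le_trans _ _ ((ln x + c) / h + 2)); first by rewrite lerD2r.
  by rewrite /A mulrDl; nra.
- have : ln x <= ln (block_size D gamma p).
    by rewrite ler_ln ?posrE ?block_size_gt0.
  rewrite ln_block_size//.
  have p0 : 0 < p.+1%:R :> R by [].
  have lp : 0 <= ln p.+1%:R :> R by rewrite ln_ge0// ler1n.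
  have lpp : ln p.+1%:R <= p.+1%:R :> R by rewrite ltW// ln_sublinear.
  have g1 := ler_wpM2r lp (ler_norm gamma).
  have g2 := ler_wpM2l (normr_ge0 gamma) lpp.
  have := ler_norm (ln D); have := normr_ge0 (ln D).
  have pn : 0 <= p%:R :> R by [].
  move: g1 g2; rewrite -natr1 in lpp p0 lp *; nra.
Qed.

End block.

(** * Counting large products of eigenvalues *)

Section spectrum.
Context {R : realType}.
Variables (lambda : nat -> R) (mu r q : R).
Hypotheses (lambda_ge0 : forall i, 0 <= lambda i) (mu_gt0 : 0 < mu) (r_gt0 : 0 < r).
Hypothesis lambda_equiv : (lambda : nat -> R^o) ~_\oo
  (fun i => mu * i.+1%:R `^ (- r) * (ln i.+1%:R) `^ q).

(** The factor ln i, which vanishes for i = 1, is replaced by 1 + ln i, so that the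
bound holds from the first index on. *)
Lemma eigen_upper_bound : exists2 C : R, 0 < C &
  forall i, lambda i <= C * (i.+1%:R `^ (- r) * (1 + ln i.+1%:R) `^ q).
Proof.
have [N _ leN] : \forall i \near \oo,
    lambda i <= 2 * (mu * i.+1%:R `^ (- r) * (ln i.+1%:R) `^ q).
  move/eqaddoP: lambda_equiv => /(_ 1 ltr01); apply: filterS => i /=.
  set G := mu * _ * _; rewrite mul1r => le.
  have G0 : 0 <= G by rewrite !mulr_ge0 ?powR_ge0// ltW.
  by move: le; rewrite [X in _ <= X]ger0_norm// => /ler_normlW le; rewrite mulr_natl mulr2n -lerBlDr.
have l2 : 0 < ln 2 :> R by rewrite ln_gt0// ltr1n.
have a0 : 0 < ln 2 / (1 + ln 2) :> R by rewrite divr_gt0// addr_gt0.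
have [C C0 leC] := powR_le_comparable q a0 ltr01.
pose G i : R := i.+1%:R `^ (- r) * (1 + ln i.+1%:R) `^ q.
have ln_ge i : 0 <= ln i.+1%:R :> R by rewrite ln_ge0// ler1n.
have G0 i : 0 < G i by rewrite mulr_gt0// powR_gt0// ltr_pwDl.
(* C1 takes care of the finitely many indices before the asymptotics set in. *)
pose C1 := \sum_(i < N.+1) lambda i / G i.
have C1_ge0 : 0 <= C1 by apply: sumr_ge0 => i _; rewrite divr_ge0// ltW.
have C2_gt0 : 0 < 2 * mu * C by rewrite !mulr_gt0.
exists (C1 + 2 * mu * C); first exact: ltr_wpDl.
move=> i; rewrite -/(G i) mulrDl.
have [iN|Ni] := ltnP i N.+1.
  apply: ler_wpDr; first by rewrite mulr_ge0// ltW.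
  rewrite -ler_pdivrMr// /C1 (bigD1 (Ordinal iN))//= lerDl.
  by apply: sumr_ge0 => j _; rewrite divr_ge0// ltW.
apply: ler_wpDl; first by rewrite mulr_ge0// ltW.
apply: (le_trans (leN i _)); first exact: ltnW.
rewrite /G -!mulrA; apply: ler_wpM2l => //; apply: ler_wpM2l; first exact: ltW.
rewrite [leRHS]mulrCA; apply: ler_wpM2l; first exact: powR_ge0.
apply: leC; rewrite ?ltr_pwDl// ?mul1r ?lerDr//.
have l2i : ln 2 <= ln i.+1%:R :> R.
  by rewrite ler_ln ?posrE// ler_nat ltnS (leq_trans _ Ni).
by rewrite mulrAC ler_pdivrMr ?addr_gt0//; nra.
Qed.

(** If i + 1 is comparable with 2^p (p+1)^(q/r) and 1 + ln (i+1) with p+1, then the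
logarithmic factors cancel in (i+1)^(-r) (1 + ln (i+1))^q and 2^(-r p) remains.
This is why blocks of size 2^p (p+1)^(q/r) are used rather than dyadic ones. *)
Lemma eigen_blocks : exists (J : nat -> nat) (C : R), [/\ 0 < C,
  forall i, i.+1%:R <= block_size 1 (q / r) (J i) &
  forall i, lambda i <= C * (2 `^ (- r)) ^+ J i].
Proof.
have [C1 C1_gt0 leC1] := eigen_upper_bound.
have [a [b [a0 b0 cover]]] := @block_cover R 1 (q / r) ltr01.
have cover_nat i : exists p,
    [/\ i.+1%:R <= block_size 1 (q / r) p,
        p = 0 \/ block_size 1 (q / r) p <= 2 * 2 `^ `|q / r| * i.+1%:R,
        a * p.+1%:R <= 1 + ln i.+1%:R & 1 + ln i.+1%:R <= b * p.+1%:R].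
  by apply: cover; rewrite ler1n.
have [J J_spec] := boolp.choice cover_nat.
have [C2 C2_gt0 leC2] := powR_le_comparable q a0 b0.
set K : R := 2 * 2 `^ `|q / r| in J_spec *.
have K1 : 1 <= K.
  have : 2 `^ 0 <= 2 `^ `|q / r| :> R by rewrite ler_powR// ler1n.
  by rewrite powRr0 /K; lra.
have K0 : 0 < K by exact: lt_le_trans K1.
have le_K i : block_size 1 (q / r) (J i) <= K * i.+1%:R.
  have [_ [J0|//] _ _] := J_spec i.
  rewrite J0 /block_size expr0 powR1 !mulr1.
  by rewrite -[leLHS]mulr1 ler_pM// ler1n.
exists J, (C1 * (C2 * K `^ r)); split.
- by rewrite !mulr_gt0// powR_gt0.
- by move=> i; have [] := J_spec i.
move=> i; apply: (le_trans (leC1 i)); rewrite -mulrA; apply: ler_wpM2l; first exact: ltW.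
have [_ _ lna lnb] := J_spec i.
have := leC2 _ _ (ltr0Sn _ _) lna lnb.
move: (le_K i); set p := J i => le_Ki le_ln.
have B0 := @block_size_gt0 R 1 (q / r) p ltr01.
have i0 : 0 < i.+1%:R :> R by [].
have le_i : i.+1%:R `^ (- r) <= K `^ r * ((2 `^ (- r)) ^+ p * p.+1%:R `^ (- q)).
  have -> : K `^ r * ((2 `^ (- r)) ^+ p * p.+1%:R `^ (- q)) =
      (block_size 1 (q / r) p / K) `^ (- r).
    have Ki : K^-1 `^ (- r) = K `^ r.
      by rewrite -powR_inv1 ?(ltW K0)// -powRrM mulrNN mul1r.
    have Ki0 : 0 <= K^-1 by rewrite invr_ge0 ltW.
    rewrite (powRM _ (ltW B0) Ki0) Ki mulrC.
    congr (_ * _); rewrite /block_size mul1r powRM ?exprn_ge0 ?powR_ge0//.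
    rewrite -!powR_mulrn ?powR_ge0// powRAC; congr (_ * _).
    by rewrite -powRrM mulrN divfK// gt_eqF.
  rewrite !powRE ?divr_gt0// ler_expR; apply: ler_wnM2l; first by rewrite oppr_le0 ltW.
  by rewrite ler_ln ?posrE ?divr_gt0// ler_pdivrMr// [leRHS]mulrC.
apply: (@le_trans _ _ (K `^ r * ((2 `^ (- r)) ^+ p * p.+1%:R `^ (- q)) *
   (C2 * p.+1%:R `^ q))).
  by apply: ler_pM; rewrite ?powR_ge0.
rewrite le_eqVlt; apply/orP; left; apply/eqP.
have pq : p.+1%:R `^ (- q) * p.+1%:R `^ q = 1 :> R.
  by rewrite powRN mulVf// gt_eqF// powR_gt0.
rewrite -[RHS]mulr1 -[X in _ = _ * X]pq; ring.
Qed.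

End spectrum.

Section levels.
Context {R : realType}.
Variable alpha : R.

(** A superset of the multi-indices of length d whose block numbers add up to P: the
j-th block is enlarged to the initial segment of integers below its size, which
leaves the cardinality bounds unchanged. *)
Fixpoint level_seqs (d P : nat) : seq (seq nat) :=
  if d is d'.+1 then
    flatten [seq [seq i :: k | i <- iota 0 (Num.truncn (block_size 1 alpha j)),
                               k <- level_seqs d' (P - j)] | j <- iota 0 P.+1]
  else if P == 0 then [:: [::]] else [::].

Lemma level_seqsS d P : level_seqs d.+1 P =
  flatten [seq [seq i :: k | i <- iota 0 (Num.truncn (block_size 1 alpha j)),
                             k <- level_seqs d (P - j)] | j <- iota 0 P.+1].
Proof. by []. Qed.

Lemma mem_level_seqs (J : nat -> nat) (k : seq nat) :
  (forall i, i.+1%:R <= block_size 1 alpha (J i)) ->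
  k \in level_seqs (size k) (sumn [seq J i | i <- k]).
Proof.
move=> leJ; elim: k => [//|i k IH].
rewrite [size _]/= level_seqsS; apply/flatten_mapP; exists (J i).
  by rewrite mem_iota add0n ltnS /= leq_addr.
apply/allpairsP; exists (i, k); split=> //=; last by rewrite addKn.
rewrite mem_iota add0n truncn_ge_nat; first exact: leJ.
by rewrite ltW// block_size_gt0.
Qed.

Lemma size_level_seqsS d P : (size (level_seqs d.+1 P) =
  \sum_(j < P.+1) Num.truncn (block_size 1 alpha j) * size (level_seqs d (P - j)))%N.
Proof.
rewrite level_seqsS size_flatten /shape -map_comp sumnE big_map.
rewrite -(big_mkord xpredT (fun j => Num.truncn (block_size 1 alpha j) * size (level_seqs d (P - j)))%N).
by apply: eq_bigr => j _ /=; rewrite size_allpairs size_iota.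
Qed.

(** Splitting off the first index turns the cardinality into a convolution of the
block sizes.  The geometric factors multiply to 2^P, and the powers convolve to
the exponent of the next dimension. *)
Lemma size_level_seqs_le d : (0 < d)%N -> alpha != -1 -> exists2 C : R, 0 < C &
  forall P, (size (level_seqs d P))%:R <= C * (2 ^+ P * P.+1%:R `^ log_exponent d alpha).
Proof.
move=> + a1; case: d => // d _.
have le_trunc j : (Num.truncn (block_size 1 alpha j))%:R <= 2 ^+ j * j.+1%:R `^ alpha.
  by rewrite -[leRHS]mul1r mulrA truncn_le// ltW// block_size_gt0.
elim: d => [|d [C C0 leC]].
  exists 1 => // P; rewrite size_level_seqsS big_ord_recr big1 /=; last first.
    move=> j _; rewrite subn_eq0 leqNgt ltn_ord/= muln0//.
  rewrite subnn/= muln1 add0n mul1r; apply: (le_trans (le_trunc P)).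
  rewrite /log_exponent subrr add0r mul1r; by case: ifP.
have [Cc Cc0 leCc] : exists2 Cc : R, 0 < Cc & forall p,
    \sum_(j < p.+1) j.+1%:R `^ alpha * (p - j).+1%:R `^ log_exponent d.+1 alpha <=
    Cc * p.+1%:R `^ log_exponent d.+2 alpha.
  rewrite /log_exponent; have [lt1|le1] := ltP (-1) alpha.
    have -> : d.+2%:R - 1 + d.+2%:R * alpha =
        alpha + (d.+1%:R - 1 + d.+1%:R * alpha) + 1 by rewrite -(natr1 d.+1); ring.
    apply: convolution_powR_gt => //.
    have := ltr0Sn R d; nra.
  by apply: convolution_powR_lt; rewrite lt_neqAle a1.
exists (C * Cc); first by rewrite mulr_gt0.
move=> P; rewrite size_level_seqsS natr_sum.
apply: (@le_trans _ _ (C * 2 ^+ P * \sum_(j < P.+1)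
   j.+1%:R `^ alpha * (P - j).+1%:R `^ log_exponent d.+1 alpha)); last first.
  rewrite -mulrA -(mulrA C); apply: ler_wpM2l; first exact: ltW.
  by rewrite mulrCA ler_wpM2l// exprn_ge0.
rewrite mulr_sumr; apply: ler_sum => j _.
have jP : (j <= P)%N by rewrite -ltnS.
rewrite natrM; apply: (@le_trans _ _ (2 ^+ j * j.+1%:R `^ alpha *
    (C * (2 ^+ (P - j) * (P - j).+1%:R `^ log_exponent d.+1 alpha)))).
  by apply: ler_pM => //; exact: leC.
rewrite (_ : 2 ^+ P = 2 ^+ (P - j) * 2 ^+ j); last by rewrite -exprD subnK.
rewrite le_eqVlt; apply/orP; left; apply/eqP; ring.
Qed.

End levels.

Section level_sets.
Context {R : realType} {d : nat}.
Variables (lambda : nat -> R) (alpha C sigma : R) (J : nat -> nat).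
Hypotheses (d_gt0 : (0 < d)%N) (alpha_neq : alpha != -1)
  (lambda_ge0 : forall i, 0 <= lambda i) (C_gt0 : 0 < C)
  (sigma_gt0 : 0 < sigma) (sigma_lt1 : 2 * sigma ^+ 2 < 1)
  (block_J : forall i, i.+1%:R <= block_size 1 alpha (J i))
  (lambda_J : forall i, lambda i <= C * sigma ^+ J i).
Variables (e : nat -> d.-tuple nat) (g : d.-tuple nat -> nat).
Hypotheses (eK : cancel e g) (gK : cancel g e).

Let beta := log_exponent d alpha.
Let rho := 2 * sigma ^+ 2.

Definition level (n : nat) : nat := sumn [seq J i | i <- e n].

Lemma mem_level n : (e n : seq nat) \in level_seqs alpha d (level n).
Proof. by have := mem_level_seqs (e n) block_J; rewrite size_tuple. Qed.

Lemma eigen_scale_level n :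
  eigen_scale lambda (e n) ^+ 2 <= (C ^+ d) ^+ 2 * (sigma ^+ 2) ^+ level n.
Proof.
have ge0 : 0 <= eigen_scale lambda (e n) by apply: prodr_ge0.
rewrite [(sigma ^+ 2) ^+ _]exprAC -exprMn ler_sqr ?nnegrE//; last first.
  by rewrite mulr_ge0// exprn_ge0// ltW.
rewrite /eigen_scale; apply: (@le_trans _ _ (\prod_(l < d) (C * sigma ^+ J (tnth (e n) l)))).
  by apply: ler_prod => l _; rewrite lambda_ge0 lambda_J.
rewrite big_split/= prodr_const card_ord /level sumnE big_map big_tuple prodrXr.
by [].
Qed.

Lemma count_level_le N P :
  (\sum_(k < N) (level k == P) <= size (level_seqs alpha d P))%N.
Proof.
rewrite -(big_mkord xpredT (fun k => (level k == P) : nat)) -big_mkcond/=.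
rewrite sum1_count -size_filter -(size_map (fun k => e k : seq nat)).
apply: uniq_leq_size.
  rewrite map_inj_uniq ?filter_uniq ?iota_uniq//.
  by move=> i j /val_inj /(can_inj eK).
move=> s /mapP[k]; rewrite mem_filter => /andP[/eqP <- _] ->; exact: mem_level.
Qed.

(** Grouping the indices by their level P, there are at most about 2^P (P+1)^beta of
them, each contributing sigma^(2P); the level p dominates since
rho = 2 sigma^2 < 1. *)
Lemma level_series_le : exists2 K : R, 0 < K & forall p,
  (\sum_(0 <= k <oo) (eigen_scale lambda (e k) ^+ 2 * (p <= level k)%N%:R)%:E <=
   (K * (rho ^+ p * p.+1%:R `^ beta))%:E)%E.
Proof.
have [C1 C1_gt0 leC1] := @size_level_seqs_le R alpha d d_gt0 alpha_neq.
have rho_gt0 : 0 < rho by rewrite /rho mulr_gt0// exprn_gt0.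
have rho01 : 0 < rho < 1 by apply/andP; split.
have [C2 C2_gt0 leC2] := sum_geometric_poly_above beta rho01.
pose Cd := (C ^+ d) ^+ 2; have Cd_gt0 : 0 < Cd by rewrite !exprn_gt0.
exists (Cd * C1 * C2); first by rewrite mulr_gt0// mulr_gt0.
move=> p; apply: lime_le.
  by apply: is_cvg_nneseries => k _ _; rewrite lee_fin mulr_ge0// sqr_ge0.
apply: nearW => N; rewrite big_mkord sumEFin lee_fin.
pose M := (\max_(k < N) level k).+1.
have s2 : 0 <= sigma ^+ 2 by exact: sqr_ge0.
apply: (@le_trans _ _ (\sum_(k < N) \sum_(j < M) Cd * (sigma ^+ 2) ^+ (p + j) *
    (level k == p + j)%N%:R)).
  apply: ler_sum => k _; have [pk|] := leqP p (level k); last first.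
    rewrite mulr0 => _; apply: sumr_ge0 => j _.
    by rewrite mulr_ge0// mulr_ge0 ?exprn_ge0// ltW.
  have kM : (level k - p < M)%N.
    by rewrite ltnS (leq_trans (leq_subr _ _))// (leq_bigmax k).
  rewrite mulr1 (bigD1 (Ordinal kM))//= subnKC// eqxx mulr1.
  apply: ler_wpDr; last exact: eigen_scale_level.
  apply: sumr_ge0 => j _.
  by rewrite mulr_ge0// mulr_ge0 ?exprn_ge0// ltW.
rewrite exchange_big/=.
apply: (@le_trans _ _ (\sum_(j < M) Cd * C1 * (rho ^+ (p + j) * (p + j).+1%:R `^ beta))).
  apply: ler_sum => j _; rewrite -mulr_sumr -natr_sum.
  have le1 : (\sum_(k < N) (level k == p + j))%:R <= C1 * (2 ^+ (p + j) * (p + j).+1%:R `^ beta) :> R.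
    by apply: le_trans (leC1 _); rewrite ler_nat; exact: count_level_le.
  apply: (@le_trans _ _ (Cd * (sigma ^+ 2) ^+ (p + j) *
     (C1 * (2 ^+ (p + j) * (p + j).+1%:R `^ beta)))).
    by apply: ler_wpM2l => //; rewrite mulr_ge0 ?exprn_ge0// ltW.
  by rewrite /rho [(2 * _) ^+ _]exprMn le_eqVlt; apply/orP; left; apply/eqP; ring.
rewrite -mulr_sumr -(mulrA (Cd * C1) C2); apply: ler_wpM2l; last exact: leC2.
by rewrite ltW// mulr_gt0.
Qed.

(** The index 0 is added to make the set nonempty whatever the function J is. *)
Definition level_set (p : nat) : seq nat :=
  undup (0 :: [seq g k | k <- pmap insub
    (flatten [seq level_seqs alpha d P | P <- iota 0 p.+1])]).

Lemma level_set_uniq p : uniq (level_set p).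
Proof. exact: undup_uniq. Qed.

Lemma level_set_gt0 p : (0 < size (level_set p))%N.
Proof.
have : 0%N \in level_set p by rewrite mem_undup mem_head.
by case: (level_set p).
Qed.

Lemma level_setP p n : n \notin level_set p -> (p < level n)%N.
Proof.
apply: contraR; rewrite -leqNgt => np; rewrite mem_undup inE; apply/orP; right.
rewrite -(eK n); apply: map_f; rewrite mem_pmap; apply/mapP; exists (e n : seq nat).
  apply/flatten_mapP; exists (level n); last exact: mem_level.
  by rewrite mem_iota.
by rewrite valK.
Qed.

Lemma size_level_set_le : exists2 K : R, 0 < K & forall p,
  (size (level_set p))%:R <= K * (2 ^+ p * p.+1%:R `^ beta).
Proof.
have [C1 C1_gt0 leC1] := @size_level_seqs_le R alpha d d_gt0 alpha_neq.
have [C2 C2_gt0 leC2] := @sum_geometric_poly_below R beta.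
have two1 : 1 < 2 :> R by rewrite ltr1n.
have [C3 C3_gt0 leC3] := powR_le_geometric (- beta) two1.
exists (C3 + C1 * C2); first by rewrite addr_gt0// mulr_gt0.
move=> p; set y := 2 ^+ p * p.+1%:R `^ beta.
apply: (@le_trans _ _ (1 + \sum_(P < p.+1) (size (level_seqs alpha d P))%:R)).
  rewrite -natr_sum -[1]/(1%:R) -natrD ler_nat add1n.
  have size_cons (x : nat) s : size (x :: s) = (size s).+1 by [].
  apply: (leq_trans (size_undup _)); rewrite size_cons ltnS size_map size_pmap.
  apply: (leq_trans (count_size _ _)).
  rewrite size_flatten /shape -map_comp sumnE big_map.
  by rewrite -(big_mkord xpredT (fun P => size (level_seqs alpha d P))).
rewrite mulrDl; apply: lerD.
  have y0 : 0 < p.+1%:R `^ beta by rewrite powR_gt0.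
  have := ler_wpM2r (ltW y0) (leC3 p).
  by rewrite powRN mulVf ?gt_eqF// mulrA.
rewrite -mulrA; apply: (@le_trans _ _ (C1 * \sum_(P < p.+1) 2 ^+ P * P.+1%:R `^ beta)).
  by rewrite mulr_sumr; apply: ler_sum => P _; exact: leC1.
by apply: ler_wpM2l; [exact: ltW|exact: leC2].
Qed.

Lemma tail_energy_le p :
  (tail_energy (fun k => (eigen_scale lambda (e k) ^+ 2)%R) (level_set p) <=
   \sum_(0 <= k <oo) (eigen_scale lambda (e k) ^+ 2 * (p <= level k)%N%:R)%:E)%E.
Proof.
apply: lee_nneseries => [k _ _|k _]; first by rewrite lee_fin mulr_ge0// sqr_ge0.
rewrite lee_fin; apply: ler_wpM2l; first exact: sqr_ge0.
have [//|/level_setP/ltnW ->//] := boolP (k \in level_set p).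
Qed.

End level_sets.

(** * The rate of convergence *)

Lemma tuple_nat_enumeration (d : nat) : (0 < d)%N ->
  exists (e : nat -> d.-tuple nat) (g : d.-tuple nat -> nat),
    cancel e g /\ cancel g e.
Proof.
move=> d0.
have infT : infinite_set [set: d.-tuple nat].
  move=> fin; apply: infinite_nat.
  rewrite (_ : [set: nat] = (fun k : d.-tuple nat => tnth k (Ordinal d0)) @` setT).
    exact: finite_image.
  apply/seteqP; split=> // n _; exists [tuple of nseq d n] => //.
  by rewrite (tnth_nth 0) /= nth_nseq d0.
have : ([set: d.-tuple nat] #= [set: nat])%card.
  by rewrite card_eq_le; apply/andP; split; [exact: countableP|exact/infiniteP].
move/card_set_bijP => [g]; rewrite setTT_bijective => -[e gK eK].
by exists e, g.
Qed.

Section rate.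
Context {R : realType}.

(** Let p be such that n is comparable with D 2^p (p+1)^(beta+1).  Then n / m is at
least a multiple of p+1, which is large if D is, so that exp(- n / m) is below
the tail 2^((1-2r) p) (p+1)^beta.  Expressing 2^p through n in the latter gives
n^(1-2r) times p+1 to the power beta + (2r-1)(beta+1) = 2r(beta+1) - 1, and p+1
is comparable with ln n. *)
Lemma rate_choice (r beta K1 : R) : 1 / 2 < r -> 0 < K1 ->
  exists2 C : R, 0 < C & forall n, (2 <= n)%N -> exists p, forall m,
    0 < m -> m <= K1 * (2 ^+ p * p.+1%:R `^ beta) ->
    expR (- (n%:R / m)) + (2 `^ (1 - 2 * r)) ^+ p * p.+1%:R `^ beta <=
    C * (n%:R `^ (1 - 2 * r) * (ln n%:R) `^ (2 * r * (beta + 1) - 1)).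
Proof.
move=> r_gt K1_gt0.
have l2 : 0 < ln 2 :> R by rewrite ln_gt0// ltr1n.
set gamma := beta + 1.
pose theta := (2 * r - 1) * ln 2.
have theta_gt0 : 0 < theta by rewrite /theta mulr_gt0//; lra.
have rhoE : 2 `^ (1 - 2 * r) = expR (- theta).
  by rewrite powRE// /theta; congr expR; ring.
set Kb : R := 2 * 2 `^ `|gamma|.
have Kb_gt0 : 0 < Kb by rewrite mulr_gt0// powR_gt0.
(* This D makes n / m >= (theta + 1) (p+1): the part theta p compensates the
   geometric factor of the tail, the rest its power of p+1. *)
pose D := (theta + 1) * Kb * K1.
have D_gt0 : 0 < D by rewrite /D !mulr_gt0// addr_gt0.
have [a [b [a_gt0 b_gt0 cover]]] := block_cover gamma D_gt0.
have e1 : 1 < expR 1 :> R by rewrite expR_gt1.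
have [C1 C1_gt0 leC1] := powR_le_geometric (- beta) e1.
set eta := 2 * r * gamma - 1.
have bi_gt0 : 0 < b^-1 by rewrite invr_gt0.
have ai_gt0 : 0 < (1 + ln 2) / (a * ln 2) by rewrite divr_gt0 ?addr_gt0 ?mulr_gt0.
have [C2 C2_gt0 leC2] := powR_le_comparable eta bi_gt0 ai_gt0.
pose C3 := D `^ (2 * r - 1) * C2.
have C3_gt0 : 0 < C3 by rewrite mulr_gt0// powR_gt0.
exists ((1 + C1 + 1) * C3); first by rewrite mulr_gt0// !addr_gt0.
move=> n n2; have n1 : 1 <= n%:R :> R by rewrite ler1n ltnW.
have n_gt0 : 0 < n%:R :> R by rewrite ltr0n ltnW.
have [p [np pn lna lnb]] := cover _ n1.
exists p => m m_gt0 mle.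
set rate := n%:R `^ _ * _; set y := (2 `^ _) ^+ p * p.+1%:R `^ beta.
have p_gt0 : 0 < p.+1%:R :> R by [].
have y_gt0 : 0 < y by rewrite mulr_gt0 ?exprn_gt0 ?powR_gt0.
have y_le : y <= C3 * rate.
  have lnn : ln 2 <= ln n%:R :> R by rewrite ler_ln ?posrE// ler_nat.
  have lnn_gt0 : 0 < ln n%:R :> R by exact: lt_le_trans lnn.
  have eta_le : p.+1%:R `^ eta <= C2 * ln n%:R `^ eta.
    apply: leC2 => //.
      by rewrite mulrC ler_pdivrMr//; lra.
    rewrite mulrAC ler_pdivlMr ?mulr_gt0//; nra.
  have n_le : D `^ (1 - 2 * r) * ((2 `^ (1 - 2 * r)) ^+ p *
      p.+1%:R `^ (gamma * (1 - 2 * r))) <= n%:R `^ (1 - 2 * r).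
    rewrite (_ : _ * _ = block_size D gamma p `^ (1 - 2 * r)).
      rewrite !powRE ?block_size_gt0// ler_expR; apply: ler_wnM2l; first by lra.
      by rewrite ler_ln ?posrE ?block_size_gt0.
    have two_ge0 : 0 <= 2 ^+ p :> R by rewrite exprn_ge0.
    have D2_ge0 : 0 <= D * 2 ^+ p by exact: mulr_ge0 (ltW D_gt0) two_ge0.
    rewrite /block_size (powRM _ D2_ge0 (powR_ge0 _ _)).
    rewrite (powRM _ (ltW D_gt0) two_ge0) -mulrA -powRrM; congr (_ * (_ * _)).
    by rewrite -!powR_mulrn ?powR_ge0// powRAC.
  have yE : y = D `^ (2 * r - 1) * (D `^ (1 - 2 * r) * ((2 `^ (1 - 2 * r)) ^+ p *
      p.+1%:R `^ (gamma * (1 - 2 * r)))) * p.+1%:R `^ eta.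
    have DD : D `^ (2 * r - 1) * D `^ (1 - 2 * r) = 1.
      have Dn0 : (2 * r - 1 + (1 - 2 * r) == 0) ==> (D != 0).
        by rewrite (gt_eqF D_gt0) implybT.
      by rewrite -powRD// (_ : 2 * r - 1 + (1 - 2 * r) = 0) ?powRr0//; ring.
    have pp : p.+1%:R `^ (gamma * (1 - 2 * r)) * p.+1%:R `^ eta = p.+1%:R `^ beta.
      rewrite -powRD ?pnatr_eq0 ?implybT//; congr (_ `^ _).
      by rewrite /eta /gamma; ring.
    by rewrite -[LHS]mul1r -[X in X * _ = _]DD /y -pp; ring.
  apply: (le_trans (y := D `^ (2 * r - 1) *
      (n%:R `^ (1 - 2 * r) * (C2 * ln n%:R `^ eta)))); last first.
    by rewrite le_eqVlt; apply/orP; left; apply/eqP; rewrite /C3 /rate; ring.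
  rewrite [leLHS]yE -[leLHS]mulrA; apply: ler_wpM2l; first exact: powR_ge0.
  apply: ler_pM => //; rewrite ?powR_ge0//.
  by rewrite !mulr_ge0 ?exprn_ge0 ?powR_ge0.
have exp_le : expR (- (n%:R / m)) <= (1 + C1) * y.
  have C1y : 0 <= C1 * y by rewrite mulr_ge0// ltW.
  case: pn => [p0|pn].
    rewrite (@le_trans _ _ 1)//; first by rewrite expR_le1 oppr_le0 divr_ge0 ?ltW.
    have y1 : y = 1 by rewrite /y p0 expr0 powR1 mul1r.
    by rewrite y1 mulr1 lerDl ltW.
  have nm : (theta + 1) * p.+1%:R <= n%:R / m.
    rewrite ler_pdivlMr//.
    have : (theta + 1) * p.+1%:R * m <=
        (theta + 1) * p.+1%:R * (K1 * (2 ^+ p * p.+1%:R `^ beta)).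
      by apply: ler_wpM2l => //; rewrite mulr_ge0// addr_ge0// ltW.
    move=> le; rewrite -(ler_pM2l Kb_gt0); apply: le_trans pn.
    apply: (le_trans (ler_wpM2l (ltW Kb_gt0) le)).
    rewrite /block_size /D /gamma powRD ?pnatr_eq0 ?implybT// powRr1//.
    by rewrite le_eqVlt; apply/orP; left; apply/eqP; ring.
  have y_ge : expR (- theta) ^+ p * expR (- p%:R) <= C1 * y.
    rewrite /y rhoE mulrCA; apply: ler_wpM2l; first by rewrite exprn_ge0// expR_ge0.
    have q0 : 0 < p.+1%:R `^ beta :> R by rewrite powR_gt0.
    have := ler_wpM2r (ltW q0) (leC1 p).
    rewrite powRN mulVf ?gt_eqF// -expRM_natr mul1r => le1.
    rewrite expRN -[leLHS]mul1r ler_pdivrMr ?expR_gt0//.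
    by apply: le_trans le1 _; rewrite mulrAC.
  rewrite mulrDl mul1r; apply: ler_wpDl; first exact: ltW.
  apply: le_trans y_ge.
  rewrite -expRM_natr -expRD ler_expR.
  have := pnatr_eq0 R p; rewrite -natr1 in nm *; nra.
rewrite -mulrA; apply: (@le_trans _ _ ((1 + C1 + 1) * y)); first by rewrite mulrDl mul1r lerD2r.
by apply: ler_wpM2l => //; rewrite ltW// !addr_gt0.
Qed.

End rate.

Theorem proposition3p3 (R : realType) (d : nat) (d_gt0 : (0 < d)%N)
    (dOmega : measure_display) (Omega : measurableType dOmega)
    (P : probability Omega R)
    (lambda : nat -> R) (phi : nat -> measurableTypeR R -> R)
    (xi : d.-tuple nat -> {RV P >-> R})
    (X : d.-tuple (measurableTypeR R) -> Omega -> R)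
    (mu r q : R)
    (phi_orthonormal : orthonormal_system phi)
    (xi_uncorrelated : uncorrelated_standard xi)
    (lambda_ge0 : forall i, 0 <= lambda i)
    (mu_gt0 : 0 < mu) (r_gt : 1 / 2 < r) (q_neq : q != - r)
    (lambda_equiv : (lambda : nat -> R^o) ~_\oo
       (fun i => mu * i.+1%:R `^ (- r) * (ln i.+1%:R) `^ q))
    (X_field : tensor_product_field lambda phi xi X) :
  let beta := log_exponent d (q / r) in
  exists (C : R) (A : forall n, linear_algorithm d n),
    forall n, (2 <= n)%N ->
      (\int[P]_w sqnormL2
                  (fun t => X t w - eval_algorithm (A n) (X ^~ w) t)%R <=
       (C * n%:R `^ (1 - 2 * r) *
          (ln n%:R) `^ (2 * r * (beta + 1) - 1))%:E)%E.
Proof.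
move=> beta.
have r_gt0 : 0 < r by lra.
have alpha_neq : q / r != -1.
  by apply: contra q_neq => /eqP qr; rewrite -(divfK (lt0r_neq0 r_gt0) q) qr mulN1r.
have [J [C0 [C0_gt0 block_J lambda_J]]] :=
  eigen_blocks lambda_ge0 mu_gt0 r_gt0 lambda_equiv.
have [e [g [eK gK]]] := tuple_nat_enumeration d_gt0.
set sigma : R := 2 `^ (- r) in lambda_J.
have sigma_gt0 : 0 < sigma by rewrite powR_gt0.
have rhoE : 2 * sigma ^+ 2 = 2 `^ (1 - 2 * r).
  have two0 (a b : R) : (a + b == 0) ==> (2 != 0 :> R) by rewrite pnatr_eq0 implybT.
  rewrite /sigma -powR_mulrn ?powR_ge0// -powRrM -{1}(powRr1 (a := 2))// -powRD//.
  by congr (_ `^ _); ring.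
have rho_lt1 : 2 * sigma ^+ 2 < 1.
  rewrite rhoE powRE// expR_lt1 pmulr_llt0 ?ln_gt0 ?ltr1n//; lra.
have [K1 K1_gt0 size_le] := size_level_set_le d_gt0 alpha_neq g.
have [K2 K2_gt0 series_le] := level_series_le d_gt0 alpha_neq lambda_ge0 C0_gt0
  sigma_gt0 rho_lt1 block_J lambda_J eK.
have [K3 K3_gt0 rate_le] := rate_choice beta r_gt K1_gt0.
pose c k := eigen_scale lambda (e k) ^+ 2.
pose S p := level_set (q / r) g p.
have c_ge0 k : 0 <= c k by exact: sqr_ge0.
have W_fin : (\sum_(0 <= k <oo) (c k)%:E)%E \is a fin_num.
  rewrite ge0_fin_numE; last by apply: nneseries_ge0 => k _ _; rewrite lee_fin.
  apply: le_lt_trans (ltry (K2 * ((2 * sigma ^+ 2) ^+ 0 * 1%:R `^ beta))).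
  apply: le_trans (series_le 0).
  by under [leRHS]eq_eseriesr do rewrite leq0n mulr1.
pose W := fine (\sum_(0 <= k <oo) (c k)%:E)%E.
have W_ge0 : 0 <= W by apply: fine_ge0; apply: nneseries_ge0 => k _ _; rewrite lee_fin.
have tail_ge0 p : (0 <= tail_energy c (S p))%E.
  by apply: nneseries_ge0 => k _ _; rewrite lee_fin mulr_ge0.
have tail_le p : (tail_energy c (S p) <=
    (K2 * ((2 * sigma ^+ 2) ^+ p * p.+1%:R `^ beta))%:E)%E.
  apply: le_trans (series_le p).
  exact: (tail_energy_le lambda block_J eK).
have tail_fin p : tail_energy c (S p) \is a fin_num.
  by rewrite ge0_fin_numE// (le_lt_trans (tail_le p))// ltry.
suff H n : exists A : linear_algorithm d n, (2 <= n)%N ->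
    (\int[P]_w sqnormL2 (fun t => X t w - eval_algorithm A (X ^~ w) t)%R <=
     (2 * (W + 2 * K2) * K3 * n%:R `^ (1 - 2 * r) *
        (ln n%:R) `^ (2 * r * (beta + 1) - 1))%:E)%E.
  exists (2 * (W + 2 * K2) * K3), (fun n => sval (cid (H n))) => n.
  exact: (svalP (cid (H n))).
have algo p := exists_algorithm phi_orthonormal xi_uncorrelated X_field eK gK n
  (level_set_uniq (q / r) g p) (level_set_gt0 (q / r) g p)
  (esym (fineK W_fin)) (esym (fineK (tail_fin p))).
have [n2|n2] := leqP 2 n; last first.
  by have [A _] := algo 0; exists A.
have [p rate_p] := rate_le n n2.
have [A errA] := algo p; exists A => _; apply: (le_trans errA); rewrite lee_fin.
have m_gt0 : 0 < (size (S p))%:R :> R by rewrite ltr0n; exact: level_set_gt0.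
move: (rate_p _ m_gt0 (size_le p)); set m := (size (S p))%:R in m_gt0 *.
rewrite -rhoE; set y := _ ^+ p * _; set rate := _ `^ _ * _ => rate_m.
have t_le : fine (tail_energy c (S p)) <= K2 * y.
  by rewrite -lee_fin fineK.
have contraction : (1 - m^-1) ^+ n <= expR (- (n%:R / m)).
  have m1 : 1 <= m by rewrite ler1n; exact: level_set_gt0.
  rewrite -mulrN expRM_natl; apply: lerXn2r; rewrite ?nnegrE ?expR_ge0//.
    by rewrite subr_ge0 invf_le1.
  exact: expR_ge1Dx.
have y_ge0 : 0 <= y by rewrite mulr_ge0 ?powR_ge0// exprn_ge0// ltW// rhoE powR_gt0.
have E_ge0 := expR_ge0 (- (n%:R / m)).
set E := expR _ in rate_m contraction E_ge0.
rewrite -[leRHS]mulrA -/rate -/W.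
have := ler_wpM2r W_ge0 contraction.
have WK : 0 <= W + 2 * K2 by rewrite addr_ge0// mulr_ge0// ltW.
have := ler_wpM2l WK rate_m.
have := mulr_ge0 W_ge0 y_ge0; have := mulr_ge0 (ltW K2_gt0) E_ge0.
rewrite -!mulrA; move: t_le; rewrite -/m; lra.
Qed.
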